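(* Let $(S,\mathfrak n)$ be a commutative noetherian local ring and let $\omega\in\mathfrak n$ be a non-zerodivisor. Then $\mathsf{Mon}(\omega,\mathcal G)$ is a Frobenius category.
   Context: All modules are finitely generated. $\mathcal P(S)$ (resp. $\mathcal G(S)$) denotes the category of finitely generated projective (resp. Gorenstein projective) $S$-modules. $\mathsf{Mor}(S)$ is the abelian category whose objects are $S$-homomorphisms $(M\xrightarrow{f}N)$ of finitely generated $S$-modules, a morphism $(M\xrightarrow{f}N)\to(M'\xrightarrow{f'}N')$ being a pair $(\psi_1,\psi_0)$ of $S$-homomorphisms $\psi_1:M\to M'$, $\psi_0:N\to N'$ with $\psi_0f=f'\psi_1$. $\mathsf{Mon}(\omega,\mathcal G)$ is the full subcategory of $\mathsf{Mor}(S)$ whose objects are the monomorphisms $(G\xrightarrow{f}P)$ with $G\in\mathcal G(S)$, $P\in\mathcal P(S)$ and $\omega\cdot\operatorname{Coker}f=0$. The exact structure (in the sense of Quillen) on $\mathsf{Mon}(\omega,\mathcal G)$ has as conflations the short exact sequences of $\mathsf{Mor}(S)$ (i.e. componentwise exact) all of whose terms lie in $\mathsf{Mon}(\omega,\mathcal G)$. An exact category is called Frobenius if it has enough projectives and enough injectives (relative to the conflations) and the projective objects coincide with the injective objects. *)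

(* Defs.v *)
From HB Require Import structures.
From mathcomp Require Import all_boot all_order all_algebra.
From mathcomp Require Import boolp classical_sets.

Set Implicit Arguments.
Unset Strict Implicit.
Unset Printing Implicit Defensive.

Import GRing.Theory.
Local Open Scope ring_scope.

Section CommutativeAlgebra.
Variable S : comNzRingType.

Definition ideal (I : set S) : Prop :=
  [/\ I 0, forall x y, I x -> I y -> I (x + y) & forall a x, I x -> I (a * x)].

Definition finitely_generated_ideal (I : set S) : Prop :=
  exists (n : nat) (g : 'I_n -> S),
    I = [set x | exists c : 'I_n -> S, x = \sum_i c i * g i]%classic.

Definition noetherian : Prop :=
  forall I : set S, ideal I -> finitely_generated_ideal I.

Definition maximal_ideal (m : set S) : Prop :=
  [/\ ideal m, ~ m 1 &
      forall I : set S, ideal I -> ~ I 1 -> (m `<=` I)%classic -> I = m].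

(* [local_ring n] : "(S, n) is a local ring". *)
Definition local_ring (n : set S) : Prop :=
  maximal_ideal n /\ forall m : set S, maximal_ideal m -> m = n.

Definition finitely_generated (M : lmodType S) : Prop :=
  exists (n : nat) (g : 'I_n -> M),
    forall x, exists c : 'I_n -> S, x = \sum_i c i *: g i.

Definition surjective (A B : Type) (f : A -> B) : Prop :=
  forall y, exists x, f x = y.

Definition projective_module (P : lmodType S) : Prop :=
  forall (M N : lmodType S) (p : {linear M -> N}) (f : {linear P -> N}),
    surjective p -> exists g : {linear P -> M}, forall x, p (g x) = f x.

Definition fg_projective (P : lmodType S) : Prop :=
  finitely_generated P /\ projective_module P.

(* A totally acyclic complex, with differentials d_i : P_(i+1) -> P_i: an exact
   complex of finitely generated projectives that stays exact after applying
   Hom(-, Q) for each finitely generated projective Q.  As i ranges over all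
   integers, the last two clauses express exactness at every degree i + 1. *)
Definition totally_acyclic (P : int -> lmodType S)
    (d : forall i : int, {linear P (i + 1) -> P i}) : Prop :=
  [/\ forall i, fg_projective (P i),
      forall i x, d i x = 0 <-> exists y, d (i + 1) y = x
    & forall Q : lmodType S, fg_projective Q ->
      forall i (g : {linear P (i + 1) -> Q}),
        (forall y, g (d (i + 1) y) = 0) <->
        exists h : {linear P i -> Q}, forall x, h (d i x) = g x].

(* The last clause gives an isomorphism of G onto the submodule Im d_0. *)
Definition gorenstein_proj (G : lmodType S) : Prop :=
  finitely_generated G /\
  exists (P : int -> lmodType S) (d : forall i, {linear P (i + 1) -> P i}),
    totally_acyclic d /\
    exists iota : {linear G -> P 0},
      injective iota /\
      forall x, (exists u, iota u = x) <-> exists y, d 0 y = x.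

Definition short_exact (A B C : lmodType S)
    (f : {linear A -> B}) (g : {linear B -> C}) : Prop :=
  [/\ injective f, surjective g & forall b, g b = 0 <-> exists a, f a = b].

End CommutativeAlgebra.

Record preadditive := Preadditive {
  ob :> Type;
  hom : ob -> ob -> zmodType;
  idm : forall A, hom A A;
  compm : forall A B C, hom B C -> hom A B -> hom A C;
  compmA : forall A B C D (h : hom C D) (g : hom B C) (f : hom A B),
    compm h (compm g f) = compm (compm h g) f;
  comp1m : forall A B (f : hom A B), compm (idm B) f = f;
  compm1 : forall A B (f : hom A B), compm f (idm A) = f;
  compmDl : forall A B C (g g' : hom B C) (f : hom A B),
    compm (g + g') f = compm g f + compm g' f;
  compmDr : forall A B C (g : hom B C) (f f' : hom A B),
    compm g (f + f') = compm g f + compm g f'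
}.
Arguments hom {_} _ _.
Arguments idm {_} _.
Arguments compm {_ _ _ _} _ _.

Notation "g '\oc' f" := (compm g f) (at level 40, left associativity).

Section ExactCategories.
Variable C : preadditive.

Definition is_iso (A B : C) (f : hom A B) : Prop :=
  exists g : hom B A, g \oc f = idm A /\ f \oc g = idm B.

Definition additive : Prop :=
  (exists Z : C, idm Z = 0) /\
  forall A B : C, exists (X : C) (i1 : hom A X) (i2 : hom B X)
      (p1 : hom X A) (p2 : hom X B),
    [/\ p1 \oc i1 = idm A, p2 \oc i2 = idm B, p1 \oc i2 = 0, p2 \oc i1 = 0
      & i1 \oc p1 + i2 \oc p2 = idm X].

Definition is_kernel (A B D : C) (i : hom A B) (p : hom B D) : Prop :=
  p \oc i = 0 /\
  forall (T : C) (f : hom T B), p \oc f = 0 -> exists! g : hom T A, i \oc g = f.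

Definition is_cokernel (A B D : C) (i : hom A B) (p : hom B D) : Prop :=
  p \oc i = 0 /\
  forall (T : C) (f : hom B T), f \oc i = 0 -> exists! g : hom D T, g \oc p = f.

Definition is_pushout (A B A' B' : C) (i : hom A B) (f : hom A A')
    (i' : hom A' B') (f' : hom B B') : Prop :=
  f' \oc i = i' \oc f /\
  forall (T : C) (u : hom B T) (v : hom A' T), u \oc i = v \oc f ->
    exists! w : hom B' T, w \oc f' = u /\ w \oc i' = v.

Definition is_pullback (B D B' D' : C) (p : hom B D) (f : hom D' D)
    (p' : hom B' D') (f' : hom B' B) : Prop :=
  p \oc f' = f \oc p' /\
  forall (T : C) (u : hom T B) (v : hom T D'), p \oc u = f \oc v ->
    exists! w : hom T B', f' \oc w = u /\ p' \oc w = v.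

Variable conflation : forall A B D : C, hom A B -> hom B D -> Prop.

Definition inflation (A B : C) (i : hom A B) : Prop :=
  exists (D : C) (p : hom B D), conflation i p.

Definition deflation (B D : C) (p : hom B D) : Prop :=
  exists (A : C) (i : hom A B), conflation i p.

(* Quillen's axioms, in the form given by Keller and Buehler. *)
Record exact_structure : Prop := ExactStructure {
  conflation_ker_coker : forall (A B D : C) (i : hom A B) (p : hom B D),
    conflation i p -> is_kernel i p /\ is_cokernel i p;
  conflation_iso : forall (A B D A' B' D' : C)
      (i : hom A B) (p : hom B D) (i' : hom A' B') (p' : hom B' D')
      (a : hom A A') (b : hom B B') (c : hom D D'),
    is_iso a -> is_iso b -> is_iso c ->
    b \oc i = i' \oc a -> c \oc p = p' \oc b ->
    conflation i p -> conflation i' p';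
  inflation_id : forall A : C, inflation (idm A);
  deflation_id : forall A : C, deflation (idm A);
  inflation_comp : forall (A B D : C) (j : hom B D) (i : hom A B),
    inflation i -> inflation j -> inflation (j \oc i);
  deflation_comp : forall (A B D : C) (q : hom B D) (p : hom A B),
    deflation p -> deflation q -> deflation (q \oc p);
  inflation_pushout : forall (A B A' : C) (i : hom A B) (f : hom A A'),
    inflation i -> exists (B' : C) (i' : hom A' B') (f' : hom B B'),
      is_pushout i f i' f' /\ inflation i';
  deflation_pullback : forall (B D D' : C) (p : hom B D) (f : hom D' D),
    deflation p -> exists (B' : C) (p' : hom B' D') (f' : hom B' B),
      is_pullback p f p' f' /\ deflation p'
}.

Definition projective_object (X : C) : Prop :=
  forall (B D : C) (p : hom B D) (f : hom X D), deflation p ->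
    exists g : hom X B, p \oc g = f.

Definition injective_object (X : C) : Prop :=
  forall (A B : C) (i : hom A B) (f : hom A X), inflation i ->
    exists g : hom B X, g \oc i = f.

Definition enough_projectives : Prop :=
  forall X : C, exists (P : C) (p : hom P X),
    projective_object P /\ deflation p.

Definition enough_injectives : Prop :=
  forall X : C, exists (I : C) (i : hom X I),
    injective_object I /\ inflation i.

Record frobenius : Prop := Frobenius {
  frobenius_additive : additive;
  frobenius_exact : exact_structure;
  frobenius_enough_proj : enough_projectives;
  frobenius_enough_inj : enough_injectives;
  frobenius_proj_inj : forall X : C, projective_object X <-> injective_object X
}.

End ExactCategories.

Section FullSubcategory.
Variables (C : preadditive) (P : C -> Prop).

Definition full_subcategory : preadditive := {|
  ob := {X : C | P X};
  hom := fun X Y => hom (sval X) (sval Y);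
  idm := fun X => idm (sval X);
  compm := fun X Y Z g f => g \oc f;
  compmA := fun _ _ _ _ h g f => compmA h g f;
  comp1m := fun _ _ f => comp1m f;
  compm1 := fun _ _ f => compm1 f;
  compmDl := fun _ _ _ g g' f => compmDl g g' f;
  compmDr := fun _ _ _ g f f' => compmDr g f f' |}.

End FullSubcategory.

Section MorphismCategory.
Variable S : comNzRingType.

Record mor_ob := MorOb {
  msrc : lmodType S;
  mtgt : lmodType S;
  mmap :> {linear msrc -> mtgt};
  msrc_fg : finitely_generated msrc;
  mtgt_fg : finitely_generated mtgt
}.

Record mor_hom (X Y : mor_ob) := MorHom {
  psi1 : {linear msrc X -> msrc Y};
  psi0 : {linear mtgt X -> mtgt Y};
  mor_comm : forall x, psi0 (X x) = Y (psi1 x)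
}.

Lemma linear_ext (U V : lmodType S) (f g : {linear U -> V}) : f =1 g -> f = g.
Proof.
move=> /funext; case: f g => [f cf] [g cg] /= fg.
case: _ / fg cg => cg; congr GRing.Linear.Pack.
case: cf cg => [[p] [q]] [[p'] [q']].
by rewrite (Prop_irrelevance p' p) (Prop_irrelevance q' q).
Qed.

Lemma mor_hom_ext (X Y : mor_ob) (f g : mor_hom X Y) :
  psi1 f =1 psi1 g -> psi0 f =1 psi0 g -> f = g.
Proof.
case: f g => [f1 f0 cf] [g1 g0 cg] /= /linear_ext e1 /linear_ext e0.
by case: _ / e1 cg; case: _ / e0 => cg; congr MorHom; exact: Prop_irrelevance.
Qed.

Section HomGroup.
Variables X Y : mor_ob.

HB.instance Definition _ := gen_eqMixin (mor_hom X Y).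
HB.instance Definition _ := gen_choiceMixin (mor_hom X Y).

Fact mor_zero_comm x : (\0 : {linear mtgt X -> mtgt Y}) (X x) =
  Y ((\0 : {linear msrc X -> msrc Y}) x).
Proof. by rewrite /= linear0. Qed.
Definition mor_zero : mor_hom X Y := MorHom mor_zero_comm.

Fact mor_opp_comm (f : mor_hom X Y) x :
  (\- psi0 f) (X x) = Y ((\- psi1 f) x).
Proof. by rewrite /= linearN mor_comm. Qed.
Definition mor_opp (f : mor_hom X Y) : mor_hom X Y := MorHom (mor_opp_comm f).

Fact mor_add_comm (f g : mor_hom X Y) x :
  (psi0 f \+ psi0 g) (X x) = Y ((psi1 f \+ psi1 g) x).
Proof. by rewrite /= linearD !mor_comm. Qed.
Definition mor_add (f g : mor_hom X Y) : mor_hom X Y :=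
  MorHom (mor_add_comm f g).

Fact mor_addA : associative mor_add.
Proof. by move=> f g h; apply: mor_hom_ext => x /=; rewrite addrA. Qed.
Fact mor_addC : commutative mor_add.
Proof. by move=> f g; apply: mor_hom_ext => x /=; rewrite addrC. Qed.
Fact mor_add0 : left_id mor_zero mor_add.
Proof. by move=> f; apply: mor_hom_ext => x /=; rewrite add0r. Qed.
Fact mor_addN : left_inverse mor_zero mor_opp mor_add.
Proof. by move=> f; apply: mor_hom_ext => x /=; rewrite addNr. Qed.

HB.instance Definition _ := GRing.isZmodule.Build (mor_hom X Y)
  mor_addA mor_addC mor_add0 mor_addN.

End HomGroup.

Fact mor_id_comm (X : mor_ob) x : (idfun : {linear mtgt X -> mtgt X}) (X x) =
  X ((idfun : {linear msrc X -> msrc X}) x).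
Proof. by []. Qed.
Definition mor_id (X : mor_ob) : mor_hom X X := MorHom (@mor_id_comm X).

Fact mor_comp_comm (X Y Z : mor_ob) (g : mor_hom Y Z) (f : mor_hom X Y) x :
  (psi0 g \o psi0 f) (X x) = Z ((psi1 g \o psi1 f) x).
Proof. by rewrite /= !mor_comm. Qed.
Definition mor_comp (X Y Z : mor_ob) (g : mor_hom Y Z) (f : mor_hom X Y) :
  mor_hom X Z := MorHom (mor_comp_comm g f).

Fact mor_compA (X Y Z T : mor_ob)
    (h : mor_hom Z T) (g : mor_hom Y Z) (f : mor_hom X Y) :
  mor_comp h (mor_comp g f) = mor_comp (mor_comp h g) f.
Proof. exact: mor_hom_ext. Qed.
Fact mor_comp1m (X Y : mor_ob) (f : mor_hom X Y) : mor_comp (mor_id Y) f = f.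
Proof. exact: mor_hom_ext. Qed.
Fact mor_compm1 (X Y : mor_ob) (f : mor_hom X Y) : mor_comp f (mor_id X) = f.
Proof. exact: mor_hom_ext. Qed.
Fact mor_compDl (X Y Z : mor_ob) (g g' : mor_hom Y Z) (f : mor_hom X Y) :
  mor_comp (g + g') f = mor_comp g f + mor_comp g' f.
Proof. exact: mor_hom_ext. Qed.
Fact mor_compDr (X Y Z : mor_ob) (g : mor_hom Y Z) (f f' : mor_hom X Y) :
  mor_comp g (f + f') = mor_comp g f + mor_comp g f'.
Proof. by apply: mor_hom_ext => x /=; rewrite linearD. Qed.

Definition Mor : preadditive := {|
  ob := mor_ob;
  hom := fun X Y => mor_hom X Y;
  idm := mor_id;
  compm := mor_comp;
  compmA := mor_compA;
  comp1m := mor_comp1m;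
  compm1 := mor_compm1;
  compmDl := mor_compDl;
  compmDr := mor_compDr |}.

Definition Mor_short_exact (X Y Z : Mor) (i : hom X Y) (p : hom Y Z) : Prop :=
  short_exact (psi1 i) (psi1 p) /\ short_exact (psi0 i) (psi0 p).

Variable omega : S.

(* The last clause unfolds omega * Coker f = 0 into omega * N <= Im f, where
   Coker f = N / Im f. *)
Definition in_Mon (f : Mor) : Prop :=
  [/\ gorenstein_proj (msrc f), fg_projective (mtgt f), injective f
    & forall y : mtgt f, exists x : msrc f, f x = omega *: y].

Definition Mon : preadditive := full_subcategory in_Mon.

Definition Mon_conflation (X Y Z : Mon) (i : hom X Y) (p : hom Y Z) : Prop :=
  @Mor_short_exact (sval X) (sval Y) (sval Z) i p.

End MorphismCategory.

(* Main.v *)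
(* For (f : G -> P) in Mon(omega, G) there is a unique s : P -> G with
   f s = omega and s f = omega.  Hence Hom((Q = Q), f) = Hom(Q, G),
   Hom((Q -omega-> Q), f) = Hom(Q, P), and dually Hom(f, (Q = Q)) = Hom(P, Q),
   Hom(f, (Q -omega-> Q)) = Hom(G, Q).  The first two functors are exact since
   Q is projective, the third since conflations split on targets, the fourth
   since Ext^1(G, Q) = 0; so both objects are projective and injective.  With
   q : Q ->> G and a : G >-> Q' (Q, Q' projective, Coker a Gorenstein
   projective), (Q = Q) + (P -omega-> P) ->> f and
   f >-> (Q' -omega-> Q') + (P = P) give enough of them, and every projective
   or injective object is a retract of one.
   Gorenstein projectivity is handled coinductively: it is the largest class of
   finitely generated modules X with Ext^1(X, projectives) = 0 whose members
   have a syzygy and a cosyzygy in the class.  Closure under extensions then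
   follows from the horseshoe lemma and closure under syzygies from Schanuel's
   lemma. *)

From HB Require Import structures.
From mathcomp Require Import all_boot all_order all_algebra.
From mathcomp Require Import boolp classical_sets.
Require Import Defs.

Set Implicit Arguments.
Unset Strict Implicit.
Unset Printing Implicit Defensive.

Import GRing.Theory.
Local Open Scope ring_scope.

(** * Modules *)

Section Modules.
Variable S : comNzRingType.
Implicit Types A B C D E F K L M N P Q T X : lmodType S.

Definition mklin M N (f : M -> N) (fL : linear f) : {linear M -> N} :=
  HB.pack f (GRing.isLinear.Build S M N *:%R f fL).

(** * Kernels and cokernels of linear maps *)

Section Kernel.
Variables (M N : lmodType S) (f : {linear M -> N}).

Definition kerp : {pred M} := [pred x | f x == 0].

Fact kerp_submod : submod_closed kerp.
Proof.
split=> [|a x y]; rewrite !inE ?linear0 // => /eqP fx0 /eqP fy0.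
by rewrite linearP fx0 fy0 scaler0 addr0.
Qed.

HB.instance Definition _ := GRing.isSubmodClosed.Build S M kerp kerp_submod.

Definition kernel := {x : M | kerp x}.
HB.instance Definition _ := SubChoice.on kernel.
HB.instance Definition _ := [SubChoice_isSubLmodule of kernel by <:].

End Kernel.

Lemma kernel_exists M N (f : {linear M -> N}) :
  exists K (i : {linear K -> M}),
    injective i /\ forall x, f x = 0 <-> exists k, i k = x.
Proof.
exists (kernel f), (\val : {linear kernel f -> M}); split; first exact: val_inj.
move=> x; split=> [fx0|[k <-]]; last by apply/eqP; case: k.
have kx : kerp f x by apply/eqP.
by exists (exist _ x kx).
Qed.

Section Cokernel.
Variables (M N : lmodType S) (f : {linear M -> N}).

(* A class modulo [Im f] is encoded by a chosen representative. *)
Definition coker_repr (x : N) : N :=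
  xget 0 [set y | exists u, f u = x - y]%classic.

Lemma coker_reprP x : exists u, f u = x - coker_repr x.
Proof.
rewrite /coker_repr.
apply: (@xgetI _ 0 [set y | exists u, f u = x - y]%classic x).
by exists 0; rewrite linear0 subrr.
Qed.

Lemma coker_repr_eq x y :
  coker_repr x = coker_repr y <-> exists u, f u = x - y.
Proof.
split=> [exy|[u fu]].
  have [[u fu] [v fv]] := (coker_reprP x, coker_reprP y).
  by exists (u - v); rewrite linearB fu fv exy opprB addrA subrK.
(* The sets of candidate representatives of [x] and [y] coincide, so the choice made by [xget] is
   the same for both. *)
congr xget; apply/seteqP; split=> z [v fv].
  by exists (v - u); rewrite linearB fu fv opprB addrC addrA subrK.
by exists (u + v); rewrite linearD fu fv addrA subrK.
Qed.

Lemma coker_repr_idem x : coker_repr (coker_repr x) = coker_repr x.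
Proof.
apply/coker_repr_eq; have [u fu] := coker_reprP x.
by exists (- u); rewrite linearN fu opprB.
Qed.

Definition cokernel := {x : N | coker_repr x == x}.
HB.instance Definition _ := SubChoice.on cokernel.

Definition coker_pi (x : N) : cokernel :=
  exist _ (coker_repr x) (introT eqP (coker_repr_idem x)).

Lemma coker_pi_eq x y : coker_pi x = coker_pi y <-> exists u, f u = x - y.
Proof.
split=> [/(congr1 val)/coker_repr_eq //|/coker_repr_eq e]; exact: val_inj.
Qed.

Lemma coker_piK (x : cokernel) : coker_pi (val x) = x.
Proof. by apply: val_inj => /=; case: x => x /= /eqP. Qed.

Definition coker_zero := coker_pi 0.
Definition coker_opp (x : cokernel) := coker_pi (- val x).
Definition coker_add (x y : cokernel) := coker_pi (val x + val y).
Definition coker_scale (a : S) (x : cokernel) := coker_pi (a *: val x).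

Lemma coker_piD x y : coker_pi (x + y) = coker_add (coker_pi x) (coker_pi y).
Proof.
apply/coker_pi_eq; have [[u fu] [v fv]] := (coker_reprP x, coker_reprP y).
by exists (u + v); rewrite linearD fu fv /= opprD addrACA.
Qed.

Lemma coker_piN x : coker_pi (- x) = coker_opp (coker_pi x).
Proof.
apply/coker_pi_eq; have [u fu] := coker_reprP x.
by exists (- u); rewrite linearN fu /= opprD.
Qed.

Lemma coker_piZ a x : coker_pi (a *: x) = coker_scale a (coker_pi x).
Proof.
apply/coker_pi_eq; have [u fu] := coker_reprP x.
by exists (a *: u); rewrite linearZ fu /= scalerBr.
Qed.

Fact coker_addA : associative coker_add.
Proof.
move=> x y z; rewrite -(coker_piK x) -(coker_piK y) -(coker_piK z).
by rewrite -!coker_piD addrA.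
Qed.
Fact coker_addC : commutative coker_add.
Proof. by move=> x y; rewrite /coker_add addrC. Qed.
Fact coker_add0 : left_id coker_zero coker_add.
Proof. by move=> x; rewrite -(coker_piK x) -coker_piD add0r. Qed.
Fact coker_addN : left_inverse coker_zero coker_opp coker_add.
Proof. by move=> x; rewrite -(coker_piK x) -coker_piN -coker_piD addNr. Qed.

HB.instance Definition _ := GRing.isZmodule.Build cokernel
  coker_addA coker_addC coker_add0 coker_addN.

Fact coker_scaleA a b x : coker_scale a (coker_scale b x) = coker_scale (a * b) x.
Proof. by rewrite -(coker_piK x) -!coker_piZ scalerA. Qed.
Fact coker_scale1 : left_id 1 coker_scale.
Proof. by move=> x; rewrite -(coker_piK x) -coker_piZ scale1r. Qed.
Fact coker_scaleDr : right_distributive coker_scale coker_add.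
Proof.
move=> a x y; rewrite -(coker_piK x) -(coker_piK y).
by rewrite -coker_piD -!coker_piZ scalerDr coker_piD.
Qed.
Fact coker_scaleDl x : {morph coker_scale^~ x : a b / a + b >-> coker_add a b}.
Proof. by move=> a b; rewrite -(coker_piK x) -!coker_piZ scalerDl coker_piD. Qed.

HB.instance Definition _ := GRing.Zmodule_isLmodule.Build S cokernel
  coker_scaleA coker_scale1 coker_scaleDr coker_scaleDl.

Fact coker_pi_linear : linear coker_pi.
Proof. by move=> a x y; rewrite coker_piD coker_piZ. Qed.

End Cokernel.

Lemma cokernel_exists M N (f : {linear M -> N}) :
  exists C (p : {linear N -> C}),
    surjective p /\ forall x, p x = 0 <-> exists u, f u = x.
Proof.
exists (cokernel f), (mklin (coker_pi_linear f)); split.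
  by move=> y; exists (val y); exact: coker_piK.
move=> x; have := coker_pi_eq f x 0; rewrite subr0 => <-.
by rewrite -[RHS](linear0 (mklin (coker_pi_linear f))).
Qed.

(** * Factorisations and diagram lemmas for short exact sequences *)

Lemma linear_inj_eq0 M N (f : {linear M -> N}) :
  (forall x, f x = 0 -> x = 0) -> injective f.
Proof.
by move=> f0 x y fxy; apply/subr0_eq/f0; rewrite linearB fxy subrr.
Qed.

Lemma inj_eq0 M N (f : {linear M -> N}) x : injective f -> f x = 0 -> x = 0.
Proof. by move=> fI fx; apply: fI; rewrite fx linear0. Qed.

(** Preimages are picked by choice; injectivity of [i] makes the resulting function linear. *)
Lemma factor_inj A B L (i : {linear A -> B}) (t : {linear L -> B}) :
  injective i -> (forall x, exists a, i a = t x) ->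
  exists t' : {linear L -> A}, forall x, i (t' x) = t x.
Proof.
move=> iI /choice[g gP].
have gL : linear g by move=> a x y; apply: iI; rewrite linearP !gP linearP.
by exists (mklin gL).
Qed.

Lemma factor_surj L B T (s : {linear L -> B}) (t : {linear L -> T}) :
  surjective s -> (forall x, s x = 0 -> t x = 0) ->
  exists t' : {linear B -> T}, forall x, t' (s x) = t x.
Proof.
move=> /choice[g gP] st.
have tg x y : s x = s y -> t x = t y.
  by move=> e; apply/subr0_eq; rewrite -linearB st // linearB e subrr.
have gL : linear (t \o g).
  by move=> a x y /=; rewrite -linearP; apply: tg; rewrite linearP !gP.
by exists (mklin gL) => x /=; apply: tg; rewrite gP.
Qed.

Lemma ses_kernel B C (p : {linear B -> C}) :
  surjective p -> exists A (i : {linear A -> B}), short_exact i p.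
Proof.
by move=> pS; have [A [i [iI ip]]] := kernel_exists p; exists A, i; split.
Qed.

Lemma ses_cokernel A B (i : {linear A -> B}) :
  injective i -> exists C (p : {linear B -> C}), short_exact i p.
Proof.
by move=> iI; have [C [p [pS ip]]] := cokernel_exists i; exists C, p; split.
Qed.

Lemma ses0 A B C (i : {linear A -> B}) (p : {linear B -> C}) x :
  short_exact i p -> p (i x) = 0.
Proof. by case=> _ _ /(_ (i x))[_ ->] //; exists x. Qed.

Lemma surj_comp A B C (p : {linear A -> B}) (q : {linear B -> C}) :
  surjective p -> surjective q -> surjective (q \o p).
Proof. by move=> pS qS z; have [y <-] := qS z; have [x <-] := pS y; exists x. Qed.

Definition pairl A B C (f : {linear C -> A}) (g : {linear C -> B}) :
  {linear C -> (A * B)%type}.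
Proof.
apply: (@mklin _ _ (fun x => (f x, g x))) => a x y.
by rewrite !linearP.
Defined.

Definition copairl A B C (f : {linear A -> C}) (g : {linear B -> C}) :
  {linear (A * B)%type -> C}.
Proof.
apply: (@mklin _ _ (fun x => f x.1 + g x.2)) => a x y /=.
by rewrite !linearP /= scalerDr addrACA.
Defined.

Definition inl_lin A B : {linear A -> (A * B)%type} := pairl idfun \0.
Definition inr_lin A B : {linear B -> (A * B)%type} := pairl \0 idfun.

Lemma ses_prod A B : short_exact (@inl_lin A B) (snd : {linear (A * B)%type -> B}).
Proof.
split=> [x y []//|y|[x y] /=]; first by exists (0, y).
by split=> [->|[a [_ <-]]//]; exists x.
Qed.

(** The kernel part of the kernel-cokernel sequence of a composite of epimorphisms: Ker p, Ker (q
    p), Ker q. It serves to compose deflations and to extend maps in two stages. *)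
Lemma ker_comp_ses K A B L D M (i : {linear K -> A}) (p : {linear A -> B})
    (j : {linear L -> B}) (q : {linear B -> D}) (m : {linear M -> A})
    (s : {linear K -> M}) (t : {linear M -> L}) :
  short_exact i p -> short_exact j q -> short_exact m (q \o p) ->
  (forall x, m (s x) = i x) -> (forall x, j (t x) = p (m x)) ->
  short_exact s t.
Proof.
move=> sesp sesq sesm sP tP.
have [[iI pS ip] [jI _ _] [mI _ mP]] := And3 sesp sesq sesm.
split=> [x y e|y|x]; first by apply: iI; rewrite -!sP e.
  have [x xP] := pS (j y).
  have /mP[z zx] : (q \o p) x = 0 by rewrite /= xP (ses0 _ sesq).
  by exists z; apply: jI; rewrite tP zx.
split=> [tx0|[z <-]]; last first.
  by apply: (inj_eq0 jI); rewrite tP sP (ses0 _ sesp).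
have /ip[z zP] : p (m x) = 0 by rewrite -tP tx0 linear0.
by exists z; apply: mI; rewrite sP.
Qed.

(** Dual of [ker_comp_ses]: the sequence Coker i, Coker (j i), Coker j of a composite of
    monomorphisms. *)
Lemma coker_comp_ses A B D E F C (i : {linear A -> B}) (p : {linear B -> D})
    (j : {linear B -> E}) (q : {linear E -> F}) (r : {linear E -> C})
    (s : {linear D -> C}) (t : {linear C -> F}) :
  short_exact i p -> short_exact j q -> short_exact (j \o i) r ->
  (forall x, s (p x) = r (j x)) -> (forall x, t (r x) = q x) ->
  short_exact s t.
Proof.
move=> sesp sesq sesr sP tP.
have [[_ pS ip] [jI qS jq] [_ rS rP]] := And3 sesp sesq sesr.
split=> [|y|x].
- apply: linear_inj_eq0 => y; have [x <-] := pS y.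
  by rewrite sP => /rP[z /jI <-]; exact: (ses0 _ sesp).
- by have [x <-] := qS y; exists (r x).
split=> [|[y <-]]; last first.
  by have [z <-] := pS y; rewrite sP tP (ses0 _ sesq).
have [y <-] := rS x; rewrite tP => /jq[z <-].
by exists (p z).
Qed.

(** The cokernel of [(i, f)] is a pushout of [i] along [- f]; the induced map out of [A'] is
    injective with the same cokernel [D] as [i]. *)
Lemma pushout_ses A B D A' L (i : {linear A -> B}) (p : {linear B -> D})
    (f : {linear A -> A'}) (c : {linear (B * A')%type -> L}) (p' : {linear L -> D}) :
  short_exact i p -> short_exact (pairl i f) c ->
  (forall x, p' (c x) = p x.1) -> short_exact (c \o @inr_lin B A') p'.
Proof.
move=> ses [_ cS cP] p'P; have [iI pS ip] := ses.
split=> [|y|x].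
- apply: linear_inj_eq0 => y /cP[x [/(inj_eq0 iI) x0 <-]].
  by rewrite x0 linear0.
- by have [x <-] := pS y; exists (c (x, 0)); rewrite p'P.
split=> [|[y <-]]; last by rewrite p'P linear0.
have [[b a] <-] := cS x; rewrite p'P => /ip[z /= zP].
exists (a - f z) => /=; apply/subr0_eq; rewrite -linearB; apply/cP; exists (- z).
apply: injective_projections; rewrite /= !linearN.
  by rewrite -zP sub0r.
by rewrite addrAC subrr add0r.
Qed.

(** Dually, the kernel of [(x, y) |-> p x + f y] is a pullback of [p] along [- f], and its
    projection to [D'] has the same kernel [A] as [p]. *)
Lemma pullback_ses A B D D' L (i : {linear A -> B}) (p : {linear B -> D})
    (f : {linear D' -> D}) (k : {linear L -> (B * D')%type}) (i' : {linear A -> L}) :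
  short_exact i p -> short_exact k (copairl p f) ->
  (forall x, k (i' x) = (i x, 0)) -> short_exact i' (snd \o k).
Proof.
move=> ses [kI _ kP] i'P; have [iI pS ip] := ses.
split=> [x y e|y|x].
- by apply: iI; have := i'P x; rewrite e i'P => -[].
- have [b bP] := pS (- f y); have /kP[l lP] : copairl p f (b, y) = 0.
    by rewrite /= bP addNr.
  by exists l; rewrite /= lP.
split=> [/= x0|[a <-]]; last by rewrite /= i'P.
have /ip[a aP] : p (k x).1 = 0.
  have /kP : exists l, k l = k x by exists x.
  by rewrite /= x0 linear0 addr0.
by exists a; apply: kI; rewrite i'P aP -x0; case: (k x).
Qed.

Lemma ses_iso A B D A' B' D' (i : {linear A -> B}) (p : {linear B -> D})
    (i' : {linear A' -> B'}) (p' : {linear B' -> D'})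
    (a : {linear A -> A'}) (b : {linear B -> B'}) (c : {linear D -> D'}) :
  bijective a -> bijective b -> bijective c ->
  (forall x, b (i x) = i' (a x)) -> (forall x, c (p x) = p' (b x)) ->
  short_exact i p -> short_exact i' p'.
Proof.
move=> [a' aK a'K] [b' bK b'K] [c' cK c'K] bi cp ses; have [iI pS ip] := ses.
split=> [x y|y|x].
- by move=> e; apply/(can_inj a'K)/iI/(can_inj bK); rewrite !bi !a'K.
- by have [x xP] := pS (c' y); exists (b x); rewrite -cp xP c'K.
rewrite -(b'K x) -cp; split=> [|[y]].
  by move/(inj_eq0 (can_inj cK))/ip=> [y <-]; exists (a y).
by rewrite -(a'K y) -bi => /(can_inj bK) <-; rewrite (ses0 _ ses) linear0.
Qed.

(** * Finite generation and projectivity along short exact sequences *)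

Lemma fg_surj M N (p : {linear M -> N}) :
  surjective p -> finitely_generated M -> finitely_generated N.
Proof.
move=> pS [n [g gP]]; exists n, (p \o g) => y; have [x <-] := pS y.
have [c ->] := gP x; exists c; rewrite linear_sum.
by apply: eq_bigr => i _; rewrite linearZ.
Qed.

Lemma fg_ext A B C (i : {linear A -> B}) (p : {linear B -> C}) :
  short_exact i p -> finitely_generated A -> finitely_generated C ->
  finitely_generated B.
Proof.
move=> [_ pS ip] [m [a aP]] [n [c cP]].
have /choice[c' c'P] := fun k => pS (c k).
exists (m + n)%N, (fun k => match split k with inl j => i (a j) | inr j => c' j end).
move=> x; have [w wP] := cP (p x).
have /ip[y yP] : p (x - \sum_j w j *: c' j) = 0.
  rewrite linearB linear_sum wP; apply/subr0_eq; rewrite subr0; apply/eqP.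
  by rewrite subr_eq0; apply/eqP/eq_bigr => j _; rewrite linearZ c'P.
have [v vP] := aP y.
exists (fun k => match split k with inl j => v j | inr j => w j end).
rewrite big_split_ord /= -[LHS](subrK (\sum_j w j *: c' j)) -yP vP linear_sum.
congr (_ + _); apply: eq_bigr => j _.
  by rewrite linearZ -[lshift n j]/(unsplit (inl j)) unsplitK.
by rewrite -[rshift m j]/(unsplit (inr j)) unsplitK.
Qed.

Lemma ses_split A B C (i : {linear A -> B}) (p : {linear B -> C}) :
  short_exact i p -> projective_module C ->
  exists (s : {linear C -> B}) (r : {linear B -> A}),
    (forall x, p (s x) = x) /\ forall x, i (r x) = x - s (p x).
Proof.
move=> ses pC; have [iI pS ip] := ses.
have [s sP] := pC _ _ p idfun pS; exists s.
(* The complementary projection [1 - s p] takes values in the kernel of [p], hence factors through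
   [i]. *)
have [|r rP] := @factor_inj _ _ _ i (idfun \- (s \o p)) iI.
  by move=> x; apply/ip; rewrite /= linearB sP subrr.
by exists r; split=> // x; rewrite rP.
Qed.

Lemma projective_ext A B C (i : {linear A -> B}) (p : {linear B -> C}) :
  short_exact i p -> projective_module A -> projective_module C ->
  projective_module B.
Proof.
move=> ses pA pC M N q f qS.
have [s [r [_ rP]]] := ses_split ses pC.
have [g1 g1P] := pA _ _ q (f \o i) qS.
have [g2 g2P] := pC _ _ q (f \o s) qS.
exists ((g1 \o r) \+ (g2 \o p)) => x /=.
by rewrite linearD g1P g2P /= rP linearB subrK.
Qed.

Lemma projective_retract P X (s : {linear X -> P}) (r : {linear P -> X}) :
  (forall x, r (s x) = x) -> projective_module P -> projective_module X.
Proof.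
move=> rs pP M N q f qS; have [g gP] := pP _ _ q (f \o r) qS.
by exists (g \o s) => x /=; rewrite gP /= rs.
Qed.

Lemma fg_projective_ext A B C (i : {linear A -> B}) (p : {linear B -> C}) :
  short_exact i p -> fg_projective A -> fg_projective C -> fg_projective B.
Proof.
move=> ses [fA pA] [fC pC].
by split; [exact: fg_ext ses fA fC | exact: projective_ext ses pA pC].
Qed.

Lemma fg_projective_prod P Q :
  fg_projective P -> fg_projective Q -> fg_projective (P * Q)%type.
Proof. exact/fg_projective_ext/ses_prod. Qed.

Lemma fg_projective_kernel A B C (i : {linear A -> B}) (p : {linear B -> C}) :
  short_exact i p -> fg_projective B -> fg_projective C -> fg_projective A.
Proof.
move=> ses [fB pB] [_ pC]; have [s [r [_ rP]]] := ses_split ses pC.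
have rK x : r (i x) = x.
  by case: (ses) => iI _ _; apply: iI; rewrite rP (ses0 _ ses) linear0 subr0.
split; last exact: projective_retract rK pB.
by apply: (@fg_surj B A r _ fB) => x; exists (i x).
Qed.

(** A finitely generated projective embeds in a free module [S^n], where [a] acts injectively on
    each coordinate. *)
Lemma lreg_projective (a : S) P (x : P) :
  GRing.lreg a -> fg_projective P -> a *: x = 0 -> x = 0.
Proof.
move=> areg [[n [g gP]] pP] ax0.
pose V : lmodType S := 'rV[S]_n.
have hL : linear (fun v : V => \sum_i v 0 i *: g i).
  move=> b u v; rewrite scaler_sumr -big_split; apply: eq_bigr => i _ /=.
  by rewrite !mxE scalerDl scalerA.
(* The embedding [s] is a section of the surjection from row vectors given by the generators. *)
have [|s sP] := pP _ _ (mklin hL) idfun.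
  move=> y; have [c ->] := gP y; exists (\row_i c i) => /=.
  by apply: eq_bigr => i _; rewrite mxE.
suff sx0 : s x = 0 by have := sP x; rewrite sx0 linear0 => /= <-.
apply/rowP => i; rewrite mxE; apply: areg; rewrite mulr0.
have /rowP/(_ i) : s (a *: x) = a *: s x by rewrite linearZ.
by rewrite ax0 linear0 !mxE.
Qed.

End Modules.

(** * Gorenstein projective modules *)

Section GorensteinProjectives.
Variable S : comNzRingType.
Implicit Types A B C D E K L M N P Q T X : lmodType S.

(** * Pullbacks, and vanishing of Ext against projectives *)

Lemma pullback_exists A B D D' (i : {linear A -> B}) (p : {linear B -> D})
    (f : {linear D' -> D}) : short_exact i p ->
  exists L (i' : {linear A -> L}) (p' : {linear L -> D'}) (g : {linear L -> B}),
  [/\ short_exact i' p', forall x, p (g x) = f (p' x), forall a, g (i' a) = i a,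
      forall x y, g x = g y -> p' x = p' y -> x = y
    & forall T (u : {linear T -> B}) (v : {linear T -> D'}),
      (forall x, p (u x) = f (v x)) ->
      exists w : {linear T -> L}, forall x, g (w x) = u x /\ p' (w x) = v x].
Proof.
move=> ses; have [_ pS _] := ses.
(* The pullback is the kernel of [(x, y) |-> p x - f y]; the two coordinates of [j] are its
   projections, so they jointly separate points. *)
have [|L [j sesj]] := @ses_kernel _ _ _ (copairl p (\- f)).
  by move=> y; have [b <-] := pS y; exists (b, 0); rewrite /= linear0 subr0.
have [jI _ jP] := sesj.
have lift T (u : {linear T -> B}) (v : {linear T -> D'}) :
    (forall x, p (u x) = f (v x)) ->
    exists w : {linear T -> L}, forall x, j (w x) = (u x, v x).
  move=> uv; apply: (@factor_inj _ _ _ _ j (pairl u v) jI) => x.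
  by apply/jP; rewrite /= uv subrr.
have [|i' i'P] := @lift A i \0; first by move=> x /=; rewrite linear0 (ses0 _ ses).
exists L, i', (snd \o j), (fst \o j); split.
- exact: pullback_ses ses sesj i'P.
- by move=> x; apply/subr0_eq; exact: (ses0 x sesj).
- by move=> a; rewrite /= i'P.
- by move=> x y e1 e2; apply: jI; exact: injective_projections.
by move=> T u v /lift[w wP]; exists w => x; rewrite /= wP.
Qed.

Lemma zero_fg_projective : fg_projective ('rV[S]_0 : lmodType S).
Proof.
split; last by move=> M N p f _; exists \0 => x; rewrite (thinmx0 x) !linear0.
by exists 0%N, (fun _ => 0) => x; exists (fun _ => 0); rewrite !thinmx0.
Qed.

Lemma ses_0l M : short_exact (\0 : {linear 'rV[S]_0 -> M}) (idfun : {linear M -> M}).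
Proof.
split=> [x y _|y|x /=]; [by rewrite !thinmx0| by exists y|].
by split=> [->|[_ <-]//]; exists 0.
Qed.

Lemma ses_0r M : short_exact (idfun : {linear M -> M}) (\0 : {linear M -> 'rV[S]_0}).
Proof.
split=> [x y //|y|x /=]; first by exists 0; rewrite (thinmx0 y).
by split=> // _; exists x.
Qed.

(* Equivalent to [Ext^1(X, Q) = 0] for every finitely generated projective Q. *)
Definition ext_vanish X : Prop :=
  forall A B (i : {linear A -> B}) (p : {linear B -> X}), short_exact i p ->
  forall Q (u : {linear A -> Q}), fg_projective Q ->
  exists v : {linear B -> Q}, forall a, v (i a) = u a.

(** One projective cover tests all extensions: any [B] over [X] receives a map from [P], which
    restricts to a map [h] between the kernels, and [B] is the pushout of [a] along [h]. *)
Lemma ext_vanish_cover A P X (a : {linear A -> P}) (b : {linear P -> X}) :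
  short_exact a b -> projective_module P ->
  (forall Q (u : {linear A -> Q}), fg_projective Q ->
     exists v : {linear P -> Q}, forall x, v (a x) = u x) ->
  ext_vanish X.
Proof.
move=> ses pP extA A' B i p ses' Q u fQ.
have [[aI bS ab] [iI pS ip]] := (ses, ses').
have [g gP] := pP _ _ p b pS.
have [|h hP] := @factor_inj _ _ _ _ i (g \o a) iI.
  by move=> x; apply/ip; rewrite /= gP (ses0 _ ses).
have [w wP] := extA Q (u \o h) fQ.
(* [B] is a quotient of [A' * P]. The map [(u, w)] descends to it because [w] extends [u h], which
   makes it vanish on the kernel. *)
have [y||v vP] := @factor_surj _ _ _ _ (copairl i g) (copairl u w).
- have [x xP] := bS (p y).
  have /ip[z zP] : p (y - g x) = 0 by rewrite linearB gP xP subrr.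
  by exists (z, x); rewrite /= zP subrK.
- move=> [y x] /= e; have /ab[z zx] : b x = 0.
    by have := congr1 p e; rewrite linearD (ses0 _ ses') add0r gP linear0.
  move: e; rewrite -zx wP /= -linearD => e.
  suff -> : y + h z = 0 by rewrite linear0.
  by apply: (inj_eq0 iI); rewrite linearD hP.
exists v => x; have := vP (x, 0); rewrite /= !linear0 !addr0.
by [].
Qed.

Lemma ext_vanish_projective P : projective_module P -> ext_vanish P.
Proof.
move=> pP A B i p ses Q u _; have [s [r [_ rP]]] := ses_split ses pP.
exists (u \o r) => a /=; congr (u _); have [iI _ _] := ses; apply: iI.
by rewrite rP (ses0 _ ses) linear0 subr0.
Qed.

(** The extension of [X] is pulled back along [r], where [u] extends; since [r s = 1], the pair
    [(1, s p)] maps [B] into this pullback compatibly with [A]. *)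
Lemma ext_vanish_retract L X (s : {linear X -> L}) (r : {linear L -> X}) :
  (forall x, r (s x) = x) -> ext_vanish L -> ext_vanish X.
Proof.
move=> rs evL A B i p ses Q u fQ.
have [L' [i' [p' [g [ses' _ gi gp lift]]]]] := pullback_exists r ses.
have [v vP] := evL _ _ _ _ ses' Q u fQ.
have [|w wP] := lift _ idfun (s \o p); first by move=> x /=; rewrite rs.
exists (v \o w) => a /=; rewrite -vP; congr (v _).
have [w1 w2] := wP (i a); apply: gp; rewrite ?w1 ?w2 ?gi //=.
by rewrite (ses0 _ ses) linear0 (ses0 _ ses').
Qed.

(** The map [u] is extended in two stages along [K -> N -> M], where [N] is the kernel of [M -> B]:
    the successive quotients are [A] and [B]. *)
Lemma ext_vanish_ext A E B (i : {linear A -> E}) (p : {linear E -> B}) :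
  short_exact i p -> ext_vanish A -> ext_vanish B -> ext_vanish E.
Proof.
move=> ses evA evB K M k m ses' Q u fQ.
have [[iI pS ip] [_ mS _]] := (ses, ses').
have [N [j sesN]] := ses_kernel (surj_comp mS pS); have [jI _ jP] := sesN.
have [|n nP] := @factor_inj _ _ _ _ i (m \o j) iI.
  by move=> x; apply/ip; apply: (ses0 _ sesN).
have [|l lP] := @factor_inj _ _ _ _ j k jI.
  by move=> x; apply/jP; rewrite /= (ses0 _ ses') linear0.
have sesA := ker_comp_ses ses' ses sesN lP nP.
have [v vP] := evA _ _ _ _ sesA Q u fQ.
have [w wP] := evB _ _ _ _ sesN Q v fQ.
by exists w => x; rewrite -lP wP vP.
Qed.

(** * Gorenstein projectives as a greatest fixed point *)

Definition syzygy_pair A C : Prop :=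
  exists P (a : {linear A -> P}) (b : {linear P -> C}),
    short_exact a b /\ fg_projective P.

(** One step of the coinductive description. A class [F] contained in [gp_step F] consists of
    Gorenstein projectives ([gp_coind]), and these form such a class themselves ([gp_unfold]). *)
Definition gp_step (F : lmodType S -> Prop) X : Prop :=
  [/\ finitely_generated X, ext_vanish X,
      exists2 C, F C & syzygy_pair X C
    & exists2 A, F A & syzygy_pair A X].

Section Coinduction.
Variable F : lmodType S -> Prop.
Hypothesis Fstep : forall X, F X -> gp_step F X.
Variables (X : lmodType S) (FX : F X).

Let next (Y : {Y | F Y}) : exists Z : {Z | F Z}, syzygy_pair (sval Y) (sval Z).
Proof.
case: Y => Y FY; have [_ _ [C FC YC] _] := Fstep FY.
by exists (exist _ C FC).
Qed.

Let prev (Y : {Y | F Y}) : exists Z : {Z | F Z}, syzygy_pair (sval Z) (sval Y).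
Proof.
case: Y => Y FY; have [_ _ _ [A FA AY]] := Fstep FY.
by exists (exist _ A FA).
Qed.

Lemma gp_resolution : exists Z : int -> lmodType S,
  [/\ Z 0 = X, forall i, F (Z i) & forall i, syzygy_pair (Z (i + 1)) (Z i)].
Proof.
have [[R RP] [L LP]] := (choice next, choice prev).
pose X0 : {Y | F Y} := exist _ X FX.
(* Syzygies are iterated in positive degrees and cosyzygies in negative ones; [Negz n] stands for
   [-(n + 1)], hence [n.+1] iterations. *)
pose Z (i : int) :=
  match i with Posz n => iter n L X0 | Negz n => iter n.+1 R X0 end.
exists (fun i => sval (Z i)); split=> [//|i|]; first exact: svalP.
case=> [n|[|n]].
- have -> : Posz n + 1 = Posz n.+1 by rewrite -PoszD addn1.
  exact: LP.
- exact: RP.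
have -> : Negz n.+1 + 1 = Negz n by rewrite !NegzE -addn1 PoszD opprD addrNK.
exact: RP.
Qed.

(** The sequences [Z (i + 1) -> P (i + 1) -> Z i] are spliced into a complex with differentials
    [a i \o b i], whose images are copies of the [Z i]. *)
Lemma gp_coind : gorenstein_proj X.
Proof.
have [Z [Z0 FZ sZ]] := gp_resolution.
(* The module [P j] and its map from [Z j] are chosen for every [j], with [j = i + 1] kept as an
   equation, so that [P i] and [P (i + 1)] belong to one family. *)
have Pa j : exists Pa : {P : lmodType S & {linear Z j -> P}},
    fg_projective (projT1 Pa) /\
    forall i, j = i + 1 -> exists b : {linear projT1 Pa -> Z i},
      short_exact (projT2 Pa) b.
  have [i ij] : exists i, j = i + 1 by exists (j - 1); rewrite subrK.
  have := sZ i; rewrite -ij => -[P [a [b [ses fP]]]].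
  exists (existT _ P a); split=> // i' /= ij'.
  have -> : i' = i by apply: (addIr 1); rewrite -ij.
  by exists b.
pose P j := projT1 (sval (cid (Pa j))).
pose a j : {linear Z j -> P j} := projT2 (sval (cid (Pa j))).
have fP j : fg_projective (P j) by have [] := svalP (cid (Pa j)).
have sesE i : exists b : {linear P (i + 1) -> Z i}, short_exact (a (i + 1)) b.
  by have [_] := svalP (cid (Pa (i + 1))); apply.
pose b i := sval (cid (sesE i)).
have ses i : short_exact (a (i + 1)) (b i) := svalP (cid (sesE i)).
have aI j : injective (a j).
  by have [i ->] : exists i, j = i + 1 by [exists (j - 1); rewrite subrK]; case: (ses i).
have bS i : surjective (b i) by case: (ses i).
pose d i : {linear P (i + 1) -> P i} := a i \o b i.
have [fX _ _ _] := Fstep FX; split=> //; exists P, d; split; last first.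
  rewrite -Z0; exists (a 0); split=> // x; split=> [[u <-]|[y <-]].
    by have [y <-] := bS 0 u; exists y.
  by exists (b 0 y).
split=> // [i x|Q fQ i g].
  split=> [/= dx0|[y <-]]; last by rewrite /= (ses0 _ (ses i)) linear0.
  have [_ _ ex] := ses i; have /ex[z <-] : b i x = 0 := inj_eq0 (@aI i) dx0.
  by have [y <-] := bS (i + 1) z; exists y.
split=> [g0|[h hP] y]; last first.
  by rewrite -hP /= (ses0 _ (ses i)) !linear0.
have ga z : g (a (i + 1) z) = 0 by have [y <-] := bS _ z; exact: g0.
(* A map killing the image of [d (i + 1)] descends to [Z i], then extends to [P i] because Ext
   vanishes on the next cosyzygy [Z (i - 1)]. *)
have [|g' gP] := @factor_surj _ _ _ _ (b i) g (@bS i).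
  by have [_ _ ex] := ses i; move=> x /ex[z <-].
have [j ij] : exists j, i = j + 1 by exists (i - 1); rewrite subrK.
subst i; have [_ ev _ _] := Fstep (FZ j).
have [h hP] := ev _ _ _ _ (ses j) Q g' fQ.
by exists h => x /=; rewrite hP gP.
Qed.

End Coinduction.

Section TotallyAcyclic.
Variables (P : int -> lmodType S) (d : forall i, {linear P (i + 1) -> P i}).
Hypothesis acyc : totally_acyclic d.

(** The modules isomorphic to some Im d_i, described by an embedding so that the class is closed
    under isomorphism. *)
Definition acyclic_image X : Prop :=
  exists i (iota : {linear X -> P i}), injective iota /\
    forall x, (exists u, iota u = x) <-> exists y, d i y = x.

(** For [X = Im d_i], the syzygy is Ker d_i = Im d_(i+1), the cosyzygy is Coker iota = Im d_(i-1),
    and exactness of Hom into projectives gives the vanishing of Ext. *)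
Lemma acyclic_image_step X : acyclic_image X -> gp_step acyclic_image X.
Proof.
case: acyc => fP ex homex [i [iota [iotaI iotaP]]].
have [|b bP] := @factor_inj _ _ _ _ iota (d i) iotaI.
  by move=> y; apply/iotaP; exists y.
have bS : surjective b.
  move=> x; have /iotaP[y yP] : exists u, iota u = iota x by exists x.
  by exists y; apply: iotaI; rewrite bP.
have [K [k ses]] := ses_kernel bS; have [kI _ kb] := ses.
have kd x : (exists u, k u = x) <-> exists y, d (i + 1) y = x.
  rewrite -kb -ex -bP; split=> [->|/(inj_eq0 iotaI)//]; exact: linear0.
have [[fPi pPi] fX] : fg_projective (P (i + 1)) /\ finitely_generated X.
  by split=> //; apply: fg_surj bS _; case: (fP (i + 1)).
split=> //; last by exists K; [exists (i + 1), k | exists (P (i + 1)), k, b].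
  apply: ext_vanish_cover ses pPi _ => Q u fQ.
  (* Here [c] is [d (i + 1)] with values in its image [K]. As [u \o c] kills the image of the next
     differential, it has the form [h \o d (i + 1)], and then [h] extends [u]. *)
  have [|c cP] := @factor_inj _ _ _ _ k (d (i + 1)) kI.
    by move=> x; apply/kd; exists x.
  have [|h hP] := (homex Q fQ (i + 1) (u \o c)).1.
    move=> y /=; have -> : c (d (i + 1 + 1) y) = 0; last exact: linear0.
    by apply: (inj_eq0 kI); rewrite cP; apply/ex; exists y.
  exists h => x; have /kd[y yP] : exists z, k z = k x by exists x.
  by rewrite -yP hP /=; congr (u _); apply: kI; rewrite cP.
have [j ij] : exists j, i = j + 1 by exists (i - 1); rewrite subrK.
subst i; have [C [p sesC]] := ses_cokernel iotaI; have [_ pS ip] := sesC.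
have pd x : p x = 0 <-> d j x = 0 by rewrite ip iotaP ex.
have [|iota' iP] := @factor_surj _ _ _ _ p (d j) pS; first by move=> x /pd.
exists C; last by exists (P (j + 1)), iota, p.
exists j, iota'; split=> [|x].
  by apply: linear_inj_eq0 => y; have [x <-] := pS y; rewrite iP => /pd.
split=> [[u <-]|[y <-]]; last by exists (p y).
by have [y <-] := pS u; exists y; rewrite iP.
Qed.

End TotallyAcyclic.

Lemma gp_unfold X : gorenstein_proj X -> gp_step (@gorenstein_proj S) X.
Proof.
move=> [_ [P [d [acyc [iota iotaP]]]]].
have gpI Y : acyclic_image d Y -> gorenstein_proj Y.
  exact: gp_coind (fun Z => @acyclic_image_step P d acyc Z) Y.
have imX : acyclic_image d X by exists 0, iota.
have [fX ev [C /gpI gC XC] [A /gpI gA AX]] := acyclic_image_step acyc imX.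
by split=> //; [exists C | exists A].
Qed.

(** By [gp_unfold], the class [gp_step gorenstein_proj] is itself closed under the step, so
    coinduction applies to it. *)
Lemma gp_fold X : gp_step (@gorenstein_proj S) X -> gorenstein_proj X.
Proof.
apply: (@gp_coind (gp_step (@gorenstein_proj S))) => Y.
move=> [fY ev [C gC YC] [A gA AY]].
by split=> //; [exists C => //| exists A => //]; exact: gp_unfold.
Qed.

(** * Closure properties of the class of Gorenstein projectives *)

Lemma gp_projective P : fg_projective P -> gorenstein_proj P.
Proof.
apply: gp_coind => {}P fP; have [fgP pP] := fP.
have f0 := zero_fg_projective.
split=> //; first exact: ext_vanish_projective.
  by exists ('rV[S]_0 : lmodType S) => //; exists P, idfun, \0; split=> //; exact: ses_0r.
by exists ('rV[S]_0 : lmodType S) => //; exists P, \0, idfun; split=> //; exact: ses_0l.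
Qed.

(** Horseshoe lemma for cosyzygies: vanishing of Ext on [B] extends [A -> QA] to [v] on [E], and
    [(v, b p)] embeds [E] in [QA * QB]. *)
Lemma syzygy_pair_ext_r A E B A' B' (i : {linear A -> E}) (p : {linear E -> B}) :
  short_exact i p -> ext_vanish B -> syzygy_pair A A' -> syzygy_pair B B' ->
  exists C (s : {linear A' -> C}) (t : {linear C -> B'}),
    short_exact s t /\ syzygy_pair E C.
Proof.
move=> ses evB [QA [a [a' [sesA fA]]]] [QB [b [b' [sesB fB]]]].
have [v vP] := evB _ _ _ _ ses QA a fA.
have [[iI pS ip] [aI a'S aP] [bI b'S bP]] := And3 ses sesA sesB.
have eI : injective (pairl v (b \o p)).
  apply: linear_inj_eq0 => x [vx0 /(inj_eq0 bI)/ip[y yx]].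
  by move: vx0; rewrite -yx vP => /(inj_eq0 aI)->; exact: linear0.
have [C [c sesC]] := ses_cokernel eI; have [_ cS cP] := sesC.
have [|s sP] := @factor_surj _ _ _ _ a' (c \o @inl_lin S QA QB) a'S.
  move=> x /aP[y <-]; apply/cP; exists (i y).
  by rewrite /= vP (ses0 _ ses) linear0.
have [|t tP] := @factor_surj _ _ _ _ c (b' \o snd) cS.
  by move=> [x y] /cP[z [_ <-]] /=; exact: (ses0 _ sesB).
exists C, s, t; split; last first.
  by exists (QA * QB)%type, (pairl v (b \o p)), c; split=> //; exact: fg_projective_prod.
split=> [|y|z].
- apply: linear_inj_eq0 => x; have [y <-] := a'S x; rewrite sP /=.
  move=> /cP[z [<- /(inj_eq0 bI)/ip[w <-]]].
  by rewrite vP; exact: (ses0 _ sesA).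
- by have [x <-] := b'S y; exists (c (0, x)); rewrite tP.
split=> [|[x <-]]; last first.
  by have [y <-] := a'S x; rewrite sP tP /= linear0.
have [[x y] <-] := cS z; rewrite tP => /= /bP[u <-]; have [w <-] := pS u.
(* Subtracting the image [(v w, b (p w))] of [w] from [(x, b (p w))] leaves [(x - v w, 0)]. *)
exists (a' (x - v w)); rewrite sP /=; apply/subr0_eq.
rewrite -linearB; apply/cP; exists (- w).
by apply: injective_projections; rewrite /= !linearN ?sub0r // addrAC subrr add0r.
Qed.

(** Horseshoe lemma: the cover [QB -> B] lifts to [l : QB -> E], and [QA * QB] covers [E]. *)
Lemma syzygy_pair_ext_l A E B A' B' (i : {linear A -> E}) (p : {linear E -> B}) :
  short_exact i p -> syzygy_pair A' A -> syzygy_pair B' B ->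
  exists K (s : {linear A' -> K}) (t : {linear K -> B'}),
    short_exact s t /\ syzygy_pair K E.
Proof.
move=> ses [QA [a [a' [sesA fA]]]] [QB [b [b' [sesB fB]]]].
have [[iI pS ip] [aI a'S aP] [bI b'S bP]] := And3 ses sesA sesB.
have [l lP] := fB.2 _ _ p b' pS.
have eS : surjective (copairl (i \o a') l).
  move=> x; have [y yP] := b'S (p x).
  have /ip[z] : p (x - l y) = 0 by rewrite linearB lP yP subrr.
  by have [w <-] := a'S z => e; exists (w, y); rewrite /= e subrK.
have [K [k sesK]] := ses_kernel eS; have [kI _ kP] := sesK.
have kE x : i (a' (k x).1) + l (k x).2 = 0 := ses0 x sesK.
have [|s sP] := @factor_inj _ _ _ _ k (@inl_lin S QA QB \o a) kI.
  by move=> x; apply/kP; rewrite /= (ses0 _ sesA) !linear0 addr0.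
have [|t tP] := @factor_inj _ _ _ _ b (snd \o k) bI.
  move=> x; apply/bP; have := congr1 p (kE x).
  by rewrite linearD (ses0 _ ses) add0r lP linear0.
exists K, s, t; split; last first.
  by exists (QA * QB)%type, k, (copairl (i \o a') l); split=> //; exact: fg_projective_prod.
split=> [x y e|y|x].
- by apply: aI; have := sP x; rewrite e sP => -[].
- have /ip[z] : p (l (b y)) = 0 by rewrite lP (ses0 _ sesB).
  have [w <-] := a'S z => e.
  have /kP[x xP] : copairl (i \o a') l (- w, b y) = 0 by rewrite /= !linearN e addNr.
  by exists x; apply: bI; rewrite tP /= xP.
split=> [tx0|[y <-]]; last by apply: (inj_eq0 bI); rewrite tP /= sP.
have k2 : (k x).2 = 0 by rewrite -[LHS]tP tx0 linear0.
have := kE x; rewrite k2 linear0 addr0 => /(inj_eq0 iI)/aP[y yP].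
by exists y; apply: kI; rewrite sP /= yP; case: (k x) k2 => ? ? /= ->.
Qed.

(** Coinduction on the class of all extensions of Gorenstein projectives, which the two horseshoe
    lemmas show to have syzygies and cosyzygies in itself. *)
Lemma gp_ext A E B (i : {linear A -> E}) (p : {linear E -> B}) :
  short_exact i p -> gorenstein_proj A -> gorenstein_proj B -> gorenstein_proj E.
Proof.
move=> ses gA gB.
pose F E := exists A B (i : {linear A -> E}) (p : {linear E -> B}),
  [/\ short_exact i p, gorenstein_proj A & gorenstein_proj B].
apply: (@gp_coind F); last by exists A, B, i, p.
move=> {A B i p ses gA gB} {}E [A [B [i [p [ses gA gB]]]]].
have [fA evA [A1 gA1 AA1] [A2 gA2 A2A]] := gp_unfold gA.
have [fB evB [B1 gB1 BB1] [B2 gB2 B2B]] := gp_unfold gB.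
split; [exact: fg_ext ses fA fB | exact: ext_vanish_ext ses evA evB | |].
  have [C [s [t [sesC EC]]]] := syzygy_pair_ext_r ses evB AA1 BB1.
  by exists C => //; exists A1, B1, s, t.
have [K [s [t [sesK KE]]]] := syzygy_pair_ext_l ses A2A B2B.
by exists K => //; exists A2, B2, s, t.
Qed.

Lemma gp_prod A B :
  gorenstein_proj A -> gorenstein_proj B -> gorenstein_proj (A * B)%type.
Proof. exact/gp_ext/ses_prod. Qed.

(** Compared with a Gorenstein projective syzygy [A] of [X], the module [K] is a retract of [A * P],
    which gives finite generation and vanishing of Ext. Its cosyzygy is [X]; its syzygy [W] is an
    extension of [Q] by a syzygy [N] of [A * P]. *)
Lemma gp_syzygy K P X (k : {linear K -> P}) (q : {linear P -> X}) :
  short_exact k q -> fg_projective P -> gorenstein_proj X -> gorenstein_proj K.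
Proof.
move=> ses fP gX; have [_ _ _ [A gA [Q [a [b [sesA fQ]]]]]] := gp_unfold gX.
have [[kI qS kq] [aI bS ab]] := (ses, sesA).
have [l lP] := fQ.2 _ _ q b qS.
have [m mP] := fP.2 _ _ b q bS.
have gL : gorenstein_proj (A * P)%type := gp_prod gA (gp_projective fP).
(* Schanuel: [A * P] is the pullback of b and q, hence [K + Q]. *)
have [|r rP] := @factor_inj _ _ _ _ k (snd \- (l \o copairl a m)) kI.
  by move=> [x y]; apply/kq; rewrite /= linearB lP linearD (ses0 _ sesA) add0r mP subrr.
have [|s sP] := @factor_inj _ _ _ _ a (\- (m \o k)) aI.
  by move=> x; apply/ab; rewrite /= linearN mP (ses0 _ ses) oppr0.
have rs x : r (pairl s k x) = x.
  by apply: kI; rewrite rP /= sP addNr linear0 subr0.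
have rS : surjective r by move=> x; exists (pairl s k x).
have [fL evL _ [N gN [R [n [c [sesN fR]]]]]] := gp_unfold gL.
apply: gp_fold; split; first exact: fg_surj rS fL.
- exact: ext_vanish_retract rs evL.
- by exists X => //; exists P, k, q.
have [_ cS nc] := sesN.
have [W [w sesW]] := ses_kernel (surj_comp cS rS); have [wI _ wP] := sesW.
exists W; last by exists R, w, (r \o c).
have wr x : k (r (c (w x))) = 0 by rewrite (ses0 x sesW : r (c (w x)) = 0) linear0.
have [|n' n'P] := @factor_inj _ _ _ _ w n wI.
  by move=> x; apply/wP; rewrite /= (ses0 _ sesN) linear0.
apply: (@gp_ext N W Q n' (copairl a m \o (c \o w))) gN (gp_projective fQ).
(* The map [(x, y) |-> a x + m y] identifies the kernel of [r] with [Q]: on that kernel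
   [y = l (a x + m y)], which gives injectivity. *)
have fst0 x y : a x + m y = 0 -> k (r (x, y)) = 0 -> (x, y) = 0.
  move=> e; rewrite rP /= e linear0 subr0 => y0.
  by move: e; rewrite y0 linear0 addr0 => /(inj_eq0 aI)->.
split=> [x y e|z|x].
- by have [nI _ _] := sesN; apply: nI; rewrite -!n'P e.
(* The preimage of [z] in the kernel of [r] is [(x, l z)] with [a x = z - m (l z)]. *)
- have /ab[x xP] : b (z - m (l z)) = 0 by rewrite linearB mP lP subrr.
  have [y yP] := cS (x, l z).
  have /wP[u uP] : (r \o c) y = 0.
    by apply: (inj_eq0 kI); rewrite /= yP rP /= xP subrK subrr.
  by exists u; rewrite /= uP yP /= xP subrK.
split=> [/= e|[y <-]]; last first.
  by rewrite /= n'P (ses0 _ sesN) /= !linear0 addr0.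
have /nc[y yP] : c (w x) = 0.
  by have := wr x; move: e; case: (c (w x)) => ? ? /=; exact: fst0.
by exists y; apply: wI; rewrite n'P.
Qed.

(** A Gorenstein projective embeds in a finitely generated projective, to which [lreg_projective]
    applies. *)
Lemma lreg_gp (a : S) X (x : X) :
  GRing.lreg a -> gorenstein_proj X -> a *: x = 0 -> x = 0.
Proof.
move=> areg /gp_unfold[_ _ [C _ [P [i [_ [[iI _ _] fP]]]]] _] ax0.
apply: (inj_eq0 iI); apply: (lreg_projective areg fP).
by rewrite -linearZ_LR ax0 linear0.
Qed.

End GorensteinProjectives.

(** * The category of monomorphisms *)

Section PreadditiveRetracts.
Variable C : preadditive.
Variable conflation : forall A B D : C, hom A B -> hom B D -> Prop.

Lemma projective_object_retract (X Y : C) (s : hom X Y) (r : hom Y X) :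
  r \oc s = idm X -> projective_object conflation Y ->
  projective_object conflation X.
Proof.
move=> rs pY B D p f dp; have [g gP] := pY _ _ _ (f \oc r) dp.
by exists (g \oc s); rewrite compmA gP -compmA rs compm1.
Qed.

Lemma injective_object_retract (X Y : C) (s : hom X Y) (r : hom Y X) :
  r \oc s = idm X -> injective_object conflation Y ->
  injective_object conflation X.
Proof.
move=> rs iY A B i f di; have [g gP] := iY _ _ _ (s \oc f) di.
by exists (r \oc g); rewrite -compmA gP compmA rs comp1m.
Qed.

End PreadditiveRetracts.

(** * Componentwise constructions in the category of module morphisms *)

Section MorphismObjects.
Variable S : comNzRingType.
Implicit Types (X Y Z T U V W L : mor_ob S) (K : lmodType S).
Local Notation "g \om f" := (mor_comp g f) (at level 40, left associativity).

Lemma mor_eq1 X Y (f g : mor_hom X Y) : f = g -> forall x, psi1 f x = psi1 g x.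
Proof. by move->. Qed.

Lemma mor_eq0 X Y (f g : mor_hom X Y) : f = g -> forall x, psi0 f x = psi0 g x.
Proof. by move->. Qed.

Definition mor_mono X Y (i : mor_hom X Y) : Prop :=
  injective (psi1 i) /\ injective (psi0 i).

Definition mor_epi X Y (p : mor_hom X Y) : Prop :=
  surjective (psi1 p) /\ surjective (psi0 p).

Lemma mor_monoP X Y T (i : mor_hom X Y) (f g : mor_hom T X) :
  mor_mono i -> i \om f = i \om g -> f = g.
Proof.
move=> [i1 i0] e; apply: mor_hom_ext => x; [apply: i1 | apply: i0].
  exact: mor_eq1 e x.
exact: mor_eq0 e x.
Qed.

Lemma mor_epiP X Y T (p : mor_hom X Y) (f g : mor_hom Y T) :
  mor_epi p -> f \om p = g \om p -> f = g.
Proof.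
move=> [p1 p0] e; apply: mor_hom_ext => y.
  by have [x <-] := p1 y; exact: mor_eq1 e x.
by have [x <-] := p0 y; exact: mor_eq0 e x.
Qed.

Lemma mor_ses_mono X Y Z (i : mor_hom X Y) (p : mor_hom Y Z) :
  Mor_short_exact i p -> mor_mono i.
Proof. by move=> [[? _ _] [? _ _]]. Qed.

Lemma mor_ses_epi X Y Z (i : mor_hom X Y) (p : mor_hom Y Z) :
  Mor_short_exact i p -> mor_epi p.
Proof. by move=> [[_ ? _] [_ ? _]]. Qed.

Lemma mor_ses0 X Y Z (i : mor_hom X Y) (p : mor_hom Y Z) :
  Mor_short_exact i p -> p \om i = 0.
Proof. by move=> [s1 s0]; apply: mor_hom_ext => x; [exact: ses0 s1 | exact: ses0 s0]. Qed.

Lemma mor_lift_mono X Y T (i : mor_hom X Y) (f : mor_hom T Y) : mor_mono i ->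
  (forall x, exists a, psi1 i a = psi1 f x) ->
  (forall x, exists a, psi0 i a = psi0 f x) ->
  exists g : mor_hom T X, i \om g = f.
Proof.
move=> [i1 i0] /(factor_inj i1)[g1 g1P] /(factor_inj i0)[g0 g0P].
have gC x : g0 (T x) = X (g1 x) by apply: i0; rewrite g0P !mor_comm g1P.
by exists (MorHom gC); apply: mor_hom_ext.
Qed.

Lemma mor_desc_epi X Y T (p : mor_hom X Y) (f : mor_hom X T) : mor_epi p ->
  (forall x, psi1 p x = 0 -> psi1 f x = 0) ->
  (forall x, psi0 p x = 0 -> psi0 f x = 0) ->
  exists g : mor_hom Y T, g \om p = f.
Proof.
move=> [p1 p0] /(factor_surj p1)[g1 g1P] /(factor_surj p0)[g0 g0P].
have gC x : g0 (Y x) = T (g1 x).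
  by have [y <-] := p1 x; rewrite -mor_comm g0P g1P mor_comm.
by exists (MorHom gC); apply: mor_hom_ext.
Qed.

Lemma mor_ses_lift X Y Z T (i : mor_hom X Y) (p : mor_hom Y Z) (f : mor_hom T Y) :
  Mor_short_exact i p -> p \om f = 0 -> exists g : mor_hom T X, i \om g = f.
Proof.
move=> ses pf; have [[_ _ e1] [_ _ e0]] := ses.
apply: (mor_lift_mono (mor_ses_mono ses)) => x; [apply/e1 | apply/e0].
  exact: mor_eq1 pf x.
exact: mor_eq0 pf x.
Qed.

Lemma mor_ses_desc X Y Z T (i : mor_hom X Y) (p : mor_hom Y Z) (f : mor_hom Y T) :
  Mor_short_exact i p -> f \om i = 0 -> exists g : mor_hom Z T, g \om p = f.
Proof.
move=> ses fi; have [[_ _ e1] [_ _ e0]] := ses.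
apply: (mor_desc_epi (mor_ses_epi ses)) => x; [case/e1 | case/e0] => y <-.
  exact: mor_eq1 fi y.
exact: mor_eq0 fi y.
Qed.

Lemma mor_cokernel X Y (i : mor_hom X Y) : mor_mono i ->
  exists Z (p : mor_hom Y Z), Mor_short_exact i p.
Proof.
move=> [i1 i0]; have [[C1 [p1 s1]] [C0 [p0 s0]]] := (ses_cokernel i1, ses_cokernel i0).
have [[_ p1S e1] [_ p0S e0]] := (s1, s0).
have [|h hP] := @factor_surj _ _ _ _ p1 (p0 \o Y) p1S.
  by move=> x /e1[z <-]; rewrite /= -mor_comm; exact: (ses0 _ s0).
pose Z := MorOb h (fg_surj p1S (msrc_fg Y)) (fg_surj p0S (mtgt_fg Y)).
have pC x : p0 (Y x) = Z (p1 x) by rewrite /= hP.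
by exists Z, (@MorHom _ Y Z p1 p0 pC).
Qed.

(** Objects of [Mor] have finitely generated components, so the two kernels must be known to be
    finitely generated before they form an object. *)
Lemma mor_kernel Y Z (p : mor_hom Y Z) : mor_epi p ->
  (forall K (k : {linear K -> msrc Y}), short_exact k (psi1 p) ->
     finitely_generated K) ->
  (forall K (k : {linear K -> mtgt Y}), short_exact k (psi0 p) ->
     finitely_generated K) ->
  exists X (i : mor_hom X Y), Mor_short_exact i p.
Proof.
move=> [p1 p0] fg1 fg0.
have [[K1 [k1 s1]] [K0 [k0 s0]]] := (ses_kernel p1, ses_kernel p0).
have [[k1I _ e1] [k0I _ e0]] := (s1, s0).
have [|h hP] := @factor_inj _ _ _ _ k0 (Y \o k1) k0I.
  by move=> x; apply/e0; rewrite /= mor_comm (ses0 _ s1) linear0.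
pose X := MorOb h (fg1 _ _ s1) (fg0 _ _ s0).
have iC x : k0 (X x) = Y (k1 x) by rewrite /= hP.
by exists X, (@MorHom _ X Y k1 k0 iC).
Qed.

Definition mor_prod_map X Y :
  {linear (msrc X * msrc Y)%type -> (mtgt X * mtgt Y)%type} :=
  pairl (X \o fst) (Y \o snd).

Lemma fg_prod (M N : lmodType S) : finitely_generated M -> finitely_generated N ->
  finitely_generated (M * N)%type.
Proof. exact: fg_ext (ses_prod M N). Qed.

Definition mor_prod X Y : mor_ob S :=
  MorOb (mor_prod_map X Y) (fg_prod (msrc_fg X) (msrc_fg Y))
    (fg_prod (mtgt_fg X) (mtgt_fg Y)).

Fact mor_pair_comm X Y T (f : mor_hom T X) (g : mor_hom T Y) x :
  pairl (psi0 f) (psi0 g) (T x) = mor_prod X Y (pairl (psi1 f) (psi1 g) x).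
Proof. by rewrite /= !mor_comm. Qed.
Definition mor_pair X Y T (f : mor_hom T X) (g : mor_hom T Y) :
  mor_hom T (mor_prod X Y) :=
  @MorHom _ T (mor_prod X Y) (pairl (psi1 f) (psi1 g)) (pairl (psi0 f) (psi0 g))
    (mor_pair_comm f g).

Fact mor_copair_comm X Y T (f : mor_hom X T) (g : mor_hom Y T) x :
  copairl (psi0 f) (psi0 g) (mor_prod X Y x) = T (copairl (psi1 f) (psi1 g) x).
Proof. by rewrite /= !mor_comm linearD. Qed.
Definition mor_copair X Y T (f : mor_hom X T) (g : mor_hom Y T) :
  mor_hom (mor_prod X Y) T :=
  @MorHom _ (mor_prod X Y) T (copairl (psi1 f) (psi1 g)) (copairl (psi0 f) (psi0 g))
    (mor_copair_comm f g).

Fact mor_fst_comm X Y x : (fst : {linear _ -> _}) (mor_prod X Y x) = X (fst x).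
Proof. by []. Qed.
Definition mor_fst X Y : mor_hom (mor_prod X Y) X :=
  @MorHom _ (mor_prod X Y) X fst fst (@mor_fst_comm X Y).

Fact mor_snd_comm X Y x : (snd : {linear _ -> _}) (mor_prod X Y x) = Y (snd x).
Proof. by []. Qed.
Definition mor_snd X Y : mor_hom (mor_prod X Y) Y :=
  @MorHom _ (mor_prod X Y) Y snd snd (@mor_snd_comm X Y).

Definition mor_inl X Y : mor_hom X (mor_prod X Y) := mor_pair (mor_id X) 0.
Definition mor_inr X Y : mor_hom Y (mor_prod X Y) := mor_pair 0 (mor_id Y).

Lemma mor_prod_ses X Y : Mor_short_exact (mor_inl X Y) (mor_snd X Y).
Proof. by split; exact: ses_prod. Qed.

Definition mor_zero_ob : mor_ob S :=
  MorOb (idfun : {linear 'rV[S]_0 -> 'rV[S]_0})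
    (zero_fg_projective S).1 (zero_fg_projective S).1.

Lemma mor_ses_0l X : Mor_short_exact (0 : mor_hom mor_zero_ob X) (mor_id X).
Proof. by split; exact: ses_0l. Qed.

Lemma mor_ses_0r X : Mor_short_exact (mor_id X) (0 : mor_hom X mor_zero_ob).
Proof. by split; exact: ses_0r. Qed.

Lemma mor_iso_bij X Y (f : mor_hom X Y) :
  (exists g : mor_hom Y X, g \om f = mor_id X /\ f \om g = mor_id Y) ->
  bijective (psi1 f) /\ bijective (psi0 f).
Proof.
move=> [g [gf fg]].
by split; [exists (psi1 g) | exists (psi0 g)] => x;
  [exact: mor_eq1 gf x | exact: mor_eq1 fg x | exact: mor_eq0 gf x | exact: mor_eq0 fg x].
Qed.

End MorphismObjects.

(** * The exact structure on the category of monomorphisms *)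

Section MonomorphismCategory.
Variables (S : comNzRingType) (omega : S).
Hypothesis omega_reg : GRing.lreg omega.
Implicit Types (X Y Z T U V W L : mor_ob S) (K : lmodType S).
Local Notation "g \om f" := (mor_comp g f) (at level 40, left associativity).
Local Notation inMon := (in_Mon omega).
Local Notation Mon := (Mon omega).
Local Notation conf := (@Mon_conflation S omega).

Definition omega_kills_coker X : Prop :=
  forall y : mtgt X, exists x : msrc X, X x = omega *: y.

(** Cokernels killed by [omega] are not closed under extensions, so that condition on [Y] is a
    hypothesis; it is supplied below by presenting [Y] as a quotient or a kernel. The other
    conditions pass to extensions. *)
Lemma inMon_ext X Y Z (i : mor_hom X Y) (p : mor_hom Y Z) :
  Mor_short_exact i p -> inMon X -> inMon Z -> omega_kills_coker Y -> inMon Y.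
Proof.
move=> [s1 s0] [gX fX XI _] [gZ fZ ZI _] wY.
split=> //; [exact: gp_ext s1 gX gZ | exact: fg_projective_ext s0 fX fZ |].
apply: linear_inj_eq0 => y Yy0.
have [[_ _ e1] [i0I _ _]] := (s1, s0).
have /e1[x xP] : psi1 p y = 0 by apply: (inj_eq0 ZI); rewrite -mor_comm Yy0 linear0.
move: Yy0; rewrite -xP -mor_comm => /(inj_eq0 i0I)/(inj_eq0 XI)->.
exact: linear0.
Qed.

Lemma omega_kills_quotient Y Z (p : mor_hom Y Z) :
  surjective (psi0 p) -> omega_kills_coker Y -> omega_kills_coker Z.
Proof.
move=> pS wY z; have [y <-] := pS z; have [x xP] := wY y.
by exists (psi1 p x); rewrite -mor_comm xP linearZ.
Qed.

(** If [Y y] is [omega] times an element of [mtgt X], then [Z] sends [psi1 p y] to 0, so [y] comes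
    from [msrc X] because [Z] is a monomorphism. *)
Lemma omega_kills_kernel X Y Z (i : mor_hom X Y) (p : mor_hom Y Z) :
  Mor_short_exact i p -> injective Z -> omega_kills_coker Y -> omega_kills_coker X.
Proof.
move=> [s1 s0] ZI wY x; have [y yP] := wY (psi0 i x).
have [[_ _ e1] [i0I _ _]] := (s1, s0).
have /e1[u uP] : psi1 p y = 0.
  by apply: (inj_eq0 ZI); rewrite -mor_comm yP linearZ_LR (ses0 _ s0) scaler0.
by exists u; apply: i0I; rewrite mor_comm uP yP linearZ.
Qed.

Lemma omega_kills_prod X Y :
  omega_kills_coker X -> omega_kills_coker Y -> omega_kills_coker (mor_prod X Y).
Proof.
move=> wX wY [x y]; have [[x' x'P] [y' y'P]] := (wX x, wY y).
by exists (x', y'); rewrite /= x'P y'P.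
Qed.

Lemma inMon_prod X Y : inMon X -> inMon Y -> inMon (mor_prod X Y).
Proof.
move=> mX mY; apply: (inMon_ext (mor_prod_ses X Y)) => //.
by apply: omega_kills_prod; [case: mX | case: mY].
Qed.

Lemma inMon_zero : inMon (mor_zero_ob S).
Proof.
have f0 := zero_fg_projective S.
split=> //; first exact: gp_projective.
by move=> y; exists (omega *: y).
Qed.

(** Inflations and deflations for bare morphisms of [Mor], without the sigma types of [Mon];
    membership of the two ends is left to the context. *)
Definition mon_inflation X Y (i : mor_hom X Y) : Prop :=
  exists Z (p : mor_hom Y Z), inMon Z /\ Mor_short_exact i p.

Definition mon_deflation Y Z (p : mor_hom Y Z) : Prop :=
  exists X (i : mor_hom X Y), inMon X /\ Mor_short_exact i p.

Lemma inflationP (X Y : Mon) (i : hom X Y) :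
  inflation conf i <-> @mon_inflation (sval X) (sval Y) i.
Proof.
split=> [[Z [p c]]|[Z [p [mZ c]]]]; last by exists (exist _ Z mZ), p.
by exists (sval Z), p; split=> //; exact: svalP.
Qed.

Lemma deflationP (Y Z : Mon) (p : hom Y Z) :
  deflation conf p <-> @mon_deflation (sval Y) (sval Z) p.
Proof.
split=> [[X [i c]]|[X [i [mX c]]]]; last by exists (exist _ X mX), i.
by exists (sval X), i; split=> //; exact: svalP.
Qed.

(** The cokernel of [j i] is an extension of those of [j] and [i], and [omega] kills the cokernel of
    its structure map because it is a quotient of [Z]. *)
Lemma mon_inflation_comp X Y Z (j : mor_hom Y Z) (i : mor_hom X Y) : inMon Z ->
  mon_inflation i -> mon_inflation j -> mon_inflation (j \om i).
Proof.
move=> mZ [D [p [mD sesp]]] [F [q [mF sesq]]].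
have [i1 i0] := mor_ses_mono sesp; have [j1 j0] := mor_ses_mono sesq.
have [|C [r sesr]] := @mor_cokernel _ _ _ (j \om i).
  by split=> x y /= => [/j1/i1|/j0/i0].
have [|s sP] := @mor_ses_desc _ _ _ _ _ _ _ (r \om j) sesp.
  by rewrite -mor_compA; exact: mor_ses0 sesr.
have [|t tP] := @mor_ses_desc _ _ _ _ _ _ _ q sesr.
  by rewrite mor_compA (mor_ses0 sesq); apply: mor_hom_ext.
exists C, r; split=> //.
apply: (@inMon_ext _ _ _ s t) => //; last first.
  by have [_ rS] := mor_ses_epi sesr; apply: omega_kills_quotient rS _; case: mZ.
split; [apply: coker_comp_ses sesp.1 sesq.1 sesr.1 _ _
       | apply: coker_comp_ses sesp.2 sesq.2 sesr.2 _ _] => x.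
- exact: mor_eq1 sP x.
- exact: mor_eq1 tP x.
- exact: mor_eq0 sP x.
- exact: mor_eq0 tP x.
Qed.

Lemma mon_deflation_comp X Y Z (q : mor_hom Y Z) (p : mor_hom X Y) :
  inMon X -> inMon Z ->
  mon_deflation p -> mon_deflation q -> mon_deflation (q \om p).
Proof.
move=> mX mZ [K [i [mK sesp]]] [L [j [mL sesq]]].
have [p1 p0] := mor_ses_epi sesp; have [q1 q0] := mor_ses_epi sesq.
(* The kernel of the composite is an extension of two finitely generated kernels, as [mor_kernel]
   requires. *)
have fgE (A B D K' L' M : lmodType S) (i' : {linear K' -> A}) (p' : {linear A -> B})
    (j' : {linear L' -> B}) (q' : {linear B -> D}) (m' : {linear M -> A}) :
    short_exact i' p' -> short_exact j' q' -> short_exact m' (q' \o p') ->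
    finitely_generated K' -> finitely_generated L' -> finitely_generated M.
  move=> sp sq sm; have [[mI _ em] [jI _ ej]] := (sm, sq).
  have [|s sP] := @factor_inj _ _ _ _ m' i' mI.
    by move=> x; apply/em; rewrite /= (ses0 _ sp) linear0.
  have [|t tP] := @factor_inj _ _ _ _ j' (p' \o m') jI.
    by move=> x; apply/ej; exact: (ses0 _ sm).
  exact: fg_ext (ker_comp_ses sp sq sm sP tP).
have [| | |M [m sesm]] := @mor_kernel _ _ _ (q \om p).
- by split; exact: surj_comp.
- by move=> N k s; apply: fgE sesp.1 sesq.1 s (msrc_fg _) (msrc_fg _).
- by move=> N k s; apply: fgE sesp.2 sesq.2 s (mtgt_fg _) (mtgt_fg _).
have [|s sP] := @mor_ses_lift _ _ _ _ _ _ _ i sesm.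
  by rewrite -mor_compA (mor_ses0 sesp); apply: mor_hom_ext => x; exact: linear0.
have [|t tP] := @mor_ses_lift _ _ _ _ _ _ _ (p \om m) sesq.
  by rewrite mor_compA; exact: mor_ses0 sesm.
exists M, m; split=> //.
apply: (@inMon_ext _ _ _ s t) => //; last first.
  by apply: omega_kills_kernel sesm _ _; [case: mZ | case: mX].
split; [apply: ker_comp_ses sesp.1 sesq.1 sesm.1 _ _
       | apply: ker_comp_ses sesp.2 sesq.2 sesm.2 _ _] => x.
- exact: mor_eq1 sP x.
- exact: mor_eq1 tP x.
- exact: mor_eq0 sP x.
- exact: mor_eq0 tP x.
Qed.

Lemma mor_copairE X Y Z (f : mor_hom (mor_prod X Y) Z) :
  f = mor_copair (f \om mor_inl X Y) (f \om mor_inr X Y).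
Proof.
by apply: mor_hom_ext => -[x y]; rewrite /= -linearD; congr (_ _);
  apply: injective_projections; rewrite /= ?addr0 ?add0r.
Qed.

(** The pushout [L] is the cokernel of [(i, - f)]. It lies in [Mon] as an extension of [Z] by [U]
    and a quotient of [Y * U], and it is universal in all of [Mor]. *)
Lemma mon_pushout X Y Z U (i : mor_hom X Y) (p : mor_hom Y Z) (f : mor_hom X U) :
  Mor_short_exact i p -> inMon Y -> inMon Z -> inMon U ->
  exists L (i' : mor_hom U L) (g : mor_hom Y L),
  [/\ inMon L, g \om i = i' \om f, mon_inflation i' &
    forall T (u : mor_hom Y T) (v : mor_hom U T), u \om i = v \om f ->
      exists! w : mor_hom L T, w \om g = u /\ w \om i' = v].
Proof.
move=> ses mY mZ mU; have [i1 i0] := mor_ses_mono ses.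
have [|L [c sesc]] := @mor_cokernel _ _ _ (mor_pair i (- f)).
  by split; apply: linear_inj_eq0 => x [/inj_eq0-> //].
have cE := mor_ses_epi sesc.
have [|p' p'P] := @mor_ses_desc _ _ _ _ _ _ _ (p \om mor_fst Y U) sesc.
  by apply: mor_hom_ext => x; [exact: (ses0 _ ses.1) | exact: (ses0 _ ses.2)].
have ses' : Mor_short_exact (c \om mor_inr Y U) p'.
  split; [apply: pushout_ses ses.1 sesc.1 _ | apply: pushout_ses ses.2 sesc.2 _] => x.
    exact: mor_eq1 p'P x.
  exact: mor_eq0 p'P x.
have mL : inMon L.
  apply: (inMon_ext ses' mU mZ); apply: omega_kills_quotient cE.2 _.
  by apply: omega_kills_prod; [case: mY | case: mU].
have cif : c \om mor_pair i (- f) = 0 := mor_ses0 sesc.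
exists L, (c \om mor_inr Y U), (c \om mor_inl Y U); split=> //; last 2 first.
- by exists Z, p'.
- move=> T u v uv.
  have [|w wP] := @mor_ses_desc _ _ _ _ _ _ _ (mor_copair u v) sesc.
    apply: mor_hom_ext => x /=; rewrite linearN; apply/eqP; rewrite subr_eq0; apply/eqP.
      exact: mor_eq1 uv x.
    exact: mor_eq0 uv x.
  (* The two pushout equations amount to one equation on [c], so uniqueness follows because [c] is
     an epimorphism. *)
  have wE (w' : mor_hom L T) : w' \om c = mor_copair u v <->
      w' \om (c \om mor_inl Y U) = u /\ w' \om (c \om mor_inr Y U) = v.
    rewrite !mor_compA; split=> [->|[eu ev]]; last by rewrite [LHS]mor_copairE eu ev.
    by split; apply: mor_hom_ext => x /=; rewrite linear0 ?addr0 ?add0r.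
  exists w; split=> [|w' /wE w'P]; first exact/wE.
  by apply: (mor_epiP cE); rewrite wP w'P.
apply: mor_hom_ext => x /=; apply/subr0_eq; rewrite -linearB.
  rewrite -[RHS](mor_eq1 cif x) /=; congr (psi1 c _).
  by apply: injective_projections; rewrite /= ?subr0 ?sub0r.
rewrite -[RHS](mor_eq0 cif x) /=; congr (psi0 c _).
by apply: injective_projections; rewrite /= ?subr0 ?sub0r.
Qed.

(** Dually, [L] is the kernel of [(p, - f)]: an extension of [U] by [X], and the kernel of a map
    from [Y * U] to the monomorphism [Z]. *)
Lemma mon_pullback X Y Z U (i : mor_hom X Y) (p : mor_hom Y Z) (f : mor_hom U Z) :
  Mor_short_exact i p -> inMon X -> inMon Y -> inMon Z -> inMon U ->
  exists L (p' : mor_hom L U) (g : mor_hom L Y),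
  [/\ inMon L, p \om g = f \om p', mon_deflation p' &
    forall T (u : mor_hom T Y) (v : mor_hom T U), p \om u = f \om v ->
      exists! w : mor_hom T L, g \om w = u /\ p' \om w = v].
Proof.
move=> ses mX mY mZ mU; have [p1 p0] := mor_ses_epi ses.
have fgE (A B D D' K : lmodType S) (i' : {linear A -> B}) (p' : {linear B -> D})
    (f' : {linear D' -> D}) (k : {linear K -> (B * D')%type}) :
    short_exact i' p' -> short_exact k (copairl p' f') ->
    finitely_generated A -> finitely_generated D' -> finitely_generated K.
  move=> si sk; have [kI _ ek] := sk.
  have [|s sP] := @factor_inj _ _ _ _ k (@inl_lin S B D' \o i') kI.
    by move=> x; apply/ek; rewrite /= (ses0 _ si) linear0 addr0.
  exact: fg_ext (pullback_ses si sk sP).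
have [| | |L [k sesk]] := @mor_kernel _ _ _ (mor_copair p (- f)).
- split=> z; [have [y <-] := p1 z | have [y <-] := p0 z];
    by exists (y, 0); rewrite /= linear0 subr0.
- by move=> N k s; apply: fgE ses.1 s (msrc_fg _) (msrc_fg _).
- by move=> N k s; apply: fgE ses.2 s (mtgt_fg _) (mtgt_fg _).
have kM := mor_ses_mono sesk.
have [|i' i'P] := @mor_ses_lift _ _ _ _ _ _ _ (mor_inl Y U \om i) sesk.
  by apply: mor_hom_ext => x; rewrite /= ?(ses0 _ ses.1) ?(ses0 _ ses.2) linear0 subr0.
have ses' : Mor_short_exact i' (mor_snd Y U \om k).
  split; [apply: pullback_ses ses.1 sesk.1 _ | apply: pullback_ses ses.2 sesk.2 _] => x.
    exact: mor_eq1 i'P x.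
  exact: mor_eq0 i'P x.
have mL : inMon L.
  apply: (inMon_ext ses' mX mU); apply: omega_kills_kernel sesk _ _; first by case: mZ.
  by apply: omega_kills_prod; [case: mY | case: mU].
have kpf : mor_copair p (- f) \om k = 0 := mor_ses0 sesk.
exists L, (mor_snd Y U \om k), (mor_fst Y U \om k); split=> //; last 2 first.
- by exists X, i'.
- move=> T u v uv.
  have [|w wP] := @mor_ses_lift _ _ _ _ _ _ _ (mor_pair u v) sesk.
    apply: mor_hom_ext => x /=; apply/eqP; rewrite subr_eq0; apply/eqP.
      exact: mor_eq1 uv x.
    exact: mor_eq0 uv x.
  have wE (w' : mor_hom T L) : k \om w' = mor_pair u v <->
      mor_fst Y U \om k \om w' = u /\ mor_snd Y U \om k \om w' = v.
    rewrite -!mor_compA; split=> [->|[eu ev]]; first by split; apply: mor_hom_ext.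
    by apply: mor_hom_ext => x; apply: injective_projections; rewrite /= -?eu -?ev.
  exists w; split=> [|w' /wE w'P]; first exact/wE.
  by apply: (mor_monoP kM); rewrite wP w'P.
apply: mor_hom_ext => x; apply/subr0_eq; first exact: mor_eq1 kpf x.
exact: mor_eq0 kpf x.
Qed.

Lemma Mon_additive : Defs.additive Mon.
Proof.
split.
  exists (exist _ _ inMon_zero).
  by apply: mor_hom_ext => x; rewrite /= (thinmx0 x).
move=> [X mX] [Y mY]; exists (exist _ _ (inMon_prod mX mY)).
exists (mor_inl X Y), (mor_inr X Y), (mor_fst X Y), (mor_snd X Y).
split; apply: mor_hom_ext => //= -[x y] /=;
  by apply: injective_projections; rewrite /= ?addr0 ?add0r.
Qed.

Lemma Mon_exact : exact_structure conf.
Proof.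
split.
- move=> [A mA] [B mB] [D mD] /= i p ses.
  have p0 := mor_ses0 ses; split; split=> // -[T mT] f /= f0.
    have [g gP] := mor_ses_lift ses f0; exists g; split=> // g' g'P.
    by apply: (mor_monoP (mor_ses_mono ses)); rewrite gP -g'P.
  have [g gP] := mor_ses_desc ses f0; exists g; split=> // g' g'P.
  by apply: (mor_epiP (mor_ses_epi ses)); rewrite gP -g'P.
- move=> A B D A' B' D' i p i' p' a b c.
  move=> /mor_iso_bij[a1 a0] /mor_iso_bij[b1 b0] /mor_iso_bij[c1 c0] bi cp [s1 s0].
  split; [apply: ses_iso a1 b1 c1 _ _ s1 | apply: ses_iso a0 b0 c0 _ _ s0] => x.
  + exact: mor_eq1 bi x.
  + exact: mor_eq1 cp x.
  + exact: mor_eq0 bi x.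
  exact: mor_eq0 cp x.
- move=> A; apply/inflationP; exists (mor_zero_ob S), 0.
  by split; [exact: inMon_zero | exact: mor_ses_0r].
- move=> A; apply/deflationP; exists (mor_zero_ob S), 0.
  by split; [exact: inMon_zero | exact: mor_ses_0l].
- move=> A B D j i /inflationP ii /inflationP ij; apply/inflationP.
  by apply: mon_inflation_comp => //; exact: svalP.
- move=> A B D q p /deflationP dp /deflationP dq; apply/deflationP.
  by apply: mon_deflation_comp => //; exact: svalP.
- move=> [A mA] [B mB] [A' mA'] i f /inflationP[Z [p [mZ ses]]].
  have [L [i' [g [mL gi ii u]]]] := mon_pushout f ses mB mZ mA'.
  exists (exist _ L mL), i', g; split; last exact/inflationP.
  by split=> // -[T mT]; exact: u.
move=> [B mB] [D mD] [D' mD'] p f /deflationP[X [i [mX ses]]].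
have [L [p' [g [mL gp dp u]]]] := mon_pullback f ses mX mB mD mD'.
exists (exist _ L mL), p', g; split; last exact/deflationP.
by split=> // -[T mT]; exact: u.
Qed.

(** * Projective and injective objects *)

Definition mon_projective X : Prop :=
  forall Y Z (p : mor_hom Y Z) (f : mor_hom X Z), inMon Y -> inMon Z ->
  mon_deflation p -> exists g : mor_hom X Y, p \om g = f.

Definition mon_injective X : Prop :=
  forall Y Z (i : mor_hom Y Z) (f : mor_hom Y X), inMon Y -> inMon Z ->
  mon_inflation i -> exists g : mor_hom Z X, g \om i = f.

Lemma mon_projectiveP (X : Mon) : mon_projective (sval X) -> projective_object conf X.
Proof. by move=> pX [Y mY] [Z mZ] p f /deflationP; exact: pX. Qed.

Lemma mon_injectiveP (X : Mon) : mon_injective (sval X) -> injective_object conf X.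
Proof. by move=> iX [Y mY] [Z mZ] p f /inflationP; exact: iX. Qed.

Lemma mon_projective_prod X Y :
  mon_projective X -> mon_projective Y -> mon_projective (mor_prod X Y).
Proof.
move=> pX pY U V p f mU mV dp.
have [g gP] := pX _ _ p (f \om mor_inl X Y) mU mV dp.
have [h hP] := pY _ _ p (f \om mor_inr X Y) mU mV dp.
exists (mor_copair g h); rewrite [f]mor_copairE -gP -hP.
by apply: mor_hom_ext => x /=; rewrite linearD.
Qed.

Lemma mon_injective_prod X Y :
  mon_injective X -> mon_injective Y -> mon_injective (mor_prod X Y).
Proof.
move=> iX iY U V i f mU mV di.
have [g gP] := iX _ _ i (mor_fst X Y \om f) mU mV di.
have [h hP] := iY _ _ i (mor_snd X Y \om f) mU mV di.
exists (mor_pair g h); apply: mor_hom_ext => x; apply: injective_projections => /=.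
- exact: mor_eq1 gP x.
- exact: mor_eq1 hP x.
- exact: mor_eq0 gP x.
exact: mor_eq0 hP x.
Qed.

Fact omega_linear (M : lmodType S) : linear (fun x : M => omega *: x).
Proof. by move=> a x y; rewrite scalerDr !scalerA mulrC. Qed.
Definition omega_mul (M : lmodType S) := mklin (@omega_linear M).

(** Multiplication by [omega] on the target factors through the monomorphism [X]; cancelling [X]
    gives the second identity. *)
Lemma omega_section X : inMon X ->
  exists s : {linear mtgt X -> msrc X},
    (forall y, X (s y) = omega *: y) /\ (forall x, s (X x) = omega *: x).
Proof.
move=> [_ _ XI wX]; have [s sP] := factor_inj (t := omega_mul (mtgt X)) XI wX.
by exists s; split=> // x; apply: XI; rewrite sP linearZ.
Qed.

Definition idOb (P : lmodType S) (fP : fg_projective P) : mor_ob S :=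
  MorOb (idfun : {linear P -> P}) fP.1 fP.1.

Definition omOb (P : lmodType S) (fP : fg_projective P) : mor_ob S :=
  MorOb (omega_mul P) fP.1 fP.1.

Section StandardObjects.
Variables (P : lmodType S) (fP : fg_projective P).

Lemma inMon_idOb : inMon (idOb fP).
Proof.
by split=> //; [exact: gp_projective | move=> y; exists (omega *: y)].
Qed.

Lemma inMon_omOb : inMon (omOb fP).
Proof.
split=> //; [exact: gp_projective | | by move=> y; exists y].
by apply: linear_inj_eq0 => x; exact: (lreg_projective omega_reg fP).
Qed.

Lemma idOb_projective : mon_projective (idOb fP).
Proof.
move=> Y Z p f mY mZ [X [i [_ ses]]]; have [p1 _] := mor_ses_epi ses.
have [g gP] := fP.2 _ _ (psi1 p) (psi1 f) p1.
have gC x : (Y \o g) (idOb fP x) = Y (g x) by [].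
exists (@MorHom _ (idOb fP) Y g (Y \o g) gC).
apply: mor_hom_ext => x /=; first exact: gP.
by rewrite mor_comm gP; exact/esym/(mor_comm f).
Qed.

(** A map out of [omOb fP] is determined by its target component [g], the source component being
    [s g]; so only [g] has to be lifted. *)
Lemma omOb_projective : mon_projective (omOb fP).
Proof.
move=> Y Z p f mY mZ [X [i [_ ses]]]; have [_ p0] := mor_ses_epi ses.
have [g gP] := fP.2 _ _ (psi0 p) (psi0 f) p0.
have [s [sP _]] := omega_section mY.
have gC x : g (omOb fP x) = Y ((s \o g) x) by rewrite /= sP linearZ.
exists (@MorHom _ (omOb fP) Y (s \o g) g gC).
apply: mor_hom_ext => x /=; last exact: gP.
have [_ _ ZI _] := mZ; apply: ZI.
by rewrite -mor_comm sP linearZ gP -mor_comm /= linearZ.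
Qed.

(** A map into [idOb fP] is determined by its target component, which extends because the target
    sequence of a conflation splits. *)
Lemma idOb_injective : mon_injective (idOb fP).
Proof.
move=> X Y i f mX mY [Z [p [[_ [_ pZ] _ _] [_ s0]]]].
have [s [r [_ rP]]] := ses_split s0 pZ.
have ri x : r (psi0 i x) = x.
  by have [iI _ _] := s0; apply: iI; rewrite rP (ses0 _ s0) linear0 subr0.
have gC x : (psi0 f \o r) (Y x) = idOb fP ((psi0 f \o r \o Y) x) by [].
exists (@MorHom _ Y (idOb fP) (psi0 f \o r \o Y) (psi0 f \o r) gC).
apply: mor_hom_ext => x /=; last by rewrite ri.
by rewrite -mor_comm ri mor_comm.
Qed.

Lemma omOb_injective : mon_injective (omOb fP).
Proof.
move=> X Y i f mX mY [Z [p [[gZ _ _ _] [s1 _]]]].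
have [_ ev _ _] := gp_unfold gZ.
have [g gP] := ev _ _ _ _ s1 P (psi1 f) fP.
have [s [sP sY]] := omega_section mY.
have gC x : (g \o s) (Y x) = omOb fP (g x) by rewrite /= sY linearZ.
exists (@MorHom _ Y (omOb fP) g (g \o s) gC).
apply: mor_hom_ext => x /=; first exact: gP.
(* Equality of target components is checked after multiplying by [omega]: then [omega *: x] is some
   [X x'], and the source components are already known to agree. *)
apply/subr0_eq/(lreg_projective omega_reg fP); rewrite scalerBr.
have [_ _ _ /(_ x)[x' x'P]] := mX.
rewrite -!linearZ_LR -x'P /= !mor_comm sY linearZ gP /=.
by rewrite subrr.
Qed.

End StandardObjects.

Lemma enough_proj_inj_l X : inMon X -> exists Y (p : mor_hom Y X),
  [/\ inMon Y, mon_projective Y, mon_injective Y & mon_deflation p].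
Proof.
move=> mX; have [gX fX XI wX] := mX.
have [fgX _ _ [K gK [Q [a [q [sesa fQ]]]]]] := gp_unfold gX.
have [s [sP sX]] := omega_section mX.
have h1C x : (X \o q) (idOb fQ x) = X (q x) by [].
have h2C x : (idfun : {linear mtgt X -> mtgt X}) (omOb fX x) = X (s x) by rewrite sP.
pose Y := mor_prod (idOb fQ) (omOb fX).
(* On sources [p] is [(q, s)], onto because [q] is; on targets it is [(X q, 1)]. Both kernels have
   the projective middle term [Q * mtgt X], so they are Gorenstein projective and projective
   respectively. *)
pose p : mor_hom Y X := mor_copair
  (@MorHom _ (idOb fQ) X q (X \o q) h1C) (@MorHom _ (omOb fX) X s idfun h2C).
have mY : inMon Y by apply: inMon_prod; [exact: inMon_idOb | exact: inMon_omOb].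
exists Y, p; split=> //.
- by apply: mon_projective_prod; [exact: idOb_projective | exact: omOb_projective].
- by apply: mon_injective_prod; [exact: idOb_injective | exact: omOb_injective].
have fQX : fg_projective (Q * mtgt X)%type by exact: fg_projective_prod.
have pE : mor_epi p.
  split=> y; last by exists (0, y); rewrite /= !linear0 add0r.
  by have [_ qS _] := sesa; have [x <-] := qS y; exists (x, 0); rewrite /= linear0 addr0.
have [| |W [k sesk]] := mor_kernel pE.
- by move=> N n sn; case: (gp_syzygy sn fQX gX).
- by move=> N n sn; case: (fg_projective_kernel sn fQX fX).
exists W, k; split=> //; split.
- exact: gp_syzygy sesk.1 fQX gX.
- exact: fg_projective_kernel sesk.2 fQX fX.
- have [kI _] := mor_ses_mono sesk; have [_ _ YI _] := mY.
  apply: linear_inj_eq0 => x x0; apply: (inj_eq0 kI); apply: (inj_eq0 YI).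
  by rewrite -mor_comm x0 linear0.
- by apply: omega_kills_kernel sesk _ _; last by case: mY.
Qed.

Lemma enough_proj_inj_r X : inMon X -> exists Y (i : mor_hom X Y),
  [/\ inMon Y, mon_projective Y, mon_injective Y & mon_inflation i].
Proof.
move=> mX; have [gX fX XI wX] := mX.
have [fgX _ [C gC [Q [a [q [sesa fQ]]]]] _] := gp_unfold gX.
have [s [sP sX]] := omega_section mX.
have h1C x : (a \o s) (X x) = omOb fQ (a x) by rewrite /= sX linearZ.
have h2C x : (idfun : {linear mtgt X -> mtgt X}) (X x) = idOb fX (X x) by [].
pose Y := mor_prod (omOb fQ) (idOb fX).
pose i : mor_hom X Y := mor_pair
  (@MorHom _ X (omOb fQ) a (a \o s) h1C) (@MorHom _ X (idOb fX) X idfun h2C).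
have mY : inMon Y by apply: inMon_prod; [exact: inMon_omOb | exact: inMon_idOb].
exists Y, i; split=> //.
- by apply: mon_projective_prod; [exact: omOb_projective | exact: idOb_projective].
- by apply: mon_injective_prod; [exact: omOb_injective | exact: idOb_injective].
have [aI _ aq] := sesa.
have iM : mor_mono i.
  by split; apply: linear_inj_eq0 => x [] // /inj_eq0->.
have [Z [c sesc]] := mor_cokernel iM; have [c1S c0S] := mor_ses_epi sesc.
exists Z, c; split=> //; have [[_ _ e1] [_ _ e0]] := sesc; split.
(* The source of the cokernel is a pushout of [a], hence an extension of [C] by the projective
   [mtgt X]. *)
- have [|t tP] := @factor_surj _ _ _ _ (psi1 c) (q \o fst) c1S.
    by move=> x /e1[y <-]; exact: (ses0 _ sesa).
  by apply: gp_ext (pushout_ses sesa sesc.1 tP) (gp_projective fX) gC.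
(* The target component [w |-> (a (s w), w)] of [i] is a graph, so its cokernel is a copy of [Q]
   through [(y, z) |-> y - a (s z)]. *)
- have [|r rP] := @factor_surj _ _ _ _ (psi0 c) (fst \- (a \o s \o snd)) c0S.
    by move=> x /e0[y <-] /=; rewrite subrr.
  have rK x : psi0 c (r x, 0) = x.
    have [[y z] <-] := c0S x; rewrite rP; apply/subr0_eq; rewrite -linearB; apply/e0.
    exists (- z); apply: injective_projections; rewrite /= ?sub0r // !linearN.
    by rewrite addrAC subrr add0r.
  split; first exact: fg_surj c0S (mtgt_fg Y).
  exact: (@projective_retract _ Q (mtgt Z) r (psi0 c \o @inl_lin S Q (mtgt X)) rK fQ.2).
(* If [(omega *: x, y)] is the image [(a (s w), w)] of some [w], then [omega] kills [q x], so
   [x = a g] as [C] is [omega]-torsion-free. Then [s w = omega *: g], and cancelling [omega] gives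
   [X g = w]. *)
- apply: linear_inj_eq0 => z; have [[x y] <-] := c1S z.
  rewrite -mor_comm => /e0[w [e <-]]; rewrite /= in e.
  have /aq[g gx] : q x = 0.
    apply: (lreg_gp omega_reg gC); rewrite -linearZ_LR -e; exact: (ses0 _ sesa).
  apply/e1; exists g; rewrite /= gx; congr pair.
  apply/subr0_eq/(lreg_projective omega_reg fX).
  have /aI ew : a (s w) = a (omega *: g) by rewrite e -gx linearZ.
  by rewrite scalerBr -(sP w) ew linearZ subrr.
- by apply: omega_kills_quotient c0S _; case: mY.
Qed.

Lemma Mon_frobenius : frobenius conf.
Proof.
have proj (X : Mon) : exists (Y : Mon) (p : hom Y X),
    [/\ projective_object conf Y, injective_object conf Y & deflation conf p].
  have [Y [p [mY pY iY dp]]] := enough_proj_inj_l (svalP X).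
  exists (exist _ Y mY), p.
  by split; [exact: mon_projectiveP | exact: mon_injectiveP | exact/deflationP].
have inj (X : Mon) : exists (Y : Mon) (i : hom X Y),
    [/\ projective_object conf Y, injective_object conf Y & inflation conf i].
  have [Y [i [mY pY iY di]]] := enough_proj_inj_r (svalP X).
  exists (exist _ Y mY), i.
  by split; [exact: mon_projectiveP | exact: mon_injectiveP | exact/inflationP].
split=> [|||X|X]; [exact: Mon_additive | exact: Mon_exact | | |].
- by move=> X; have [Y [p [? _ ?]]] := proj X; exists Y, p.
- by have [Y [i [_ ? ?]]] := inj X; exists Y, i.
(* The chosen covers and hulls are both projective and injective; a projective is a retract of its
   cover, an injective of its hull. *)
split=> [pX|iX].
  have [Y [p [_ iY dp]]] := proj X; have [s sP] := pX _ _ p (idm X) dp.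
  exact: injective_object_retract sP iY.
have [Y [i [pY _ di]]] := inj X; have [r rP] := iX _ _ i (idm X) di.
exact: projective_object_retract rP pY.
Qed.

End MonomorphismCategory.

Theorem theorem2p16 (S : comNzRingType) (n : set S) (omega : S) :
  noetherian S -> local_ring n -> n omega -> GRing.lreg omega ->
  frobenius (@Mon_conflation S omega).
Proof. by move=> _ _ _; exact: Mon_frobenius. Qed.
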